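(* Let $n\ge0$ be an integer and define $\tilde\Phi_n:(-1,1)\to\mathbb R$ by $$\tilde\Phi_n(t)=\sum_{k=0}^\infty\alpha_k^{(n)}Q_k(t).$$ Let $t_1<\dots<t_n$ be the roots of $\psi_n$ in $(-1,1)$. Then for every $j=1,\dots,n$, $$\tilde\Phi_n(t_j)=\frac12\int_{-1}^1\frac{\psi_n(t)\,dt}{t_j-t}.$$
   Context: For a real number $c>0$, let $\psi_0,\psi_1,\dots$ be the prolate spheroidal wave functions of band limit $c$: the real $L^2[-1,1]$-normalized eigenfunctions of $F_c[\varphi](x)=\int_{-1}^1\varphi(t)e^{icxt}\,dt$ (eigenvalues ordered by decreasing absolute value); $\psi_n$ has exactly $n$ simple roots in $(-1,1)$. Let $P_k$ be the Legendre polynomials, and $\alpha_k^{(n)}=(k+\tfrac12)\int_{-1}^1\psi_n(x)P_k(x)\,dx$, so that $\psi_n=\sum_k\alpha_k^{(n)}P_k$ on $[-1,1]$. The Legendre functions of the second kind are $Q_0(t)=\frac12\log\frac{1+t}{1-t}$, $Q_1(t)=\frac t2\log\frac{1+t}{1-t}-1$, and $(k+1)Q_{k+1}(t)=(2k+1)tQ_k(t)-kQ_{k-1}(t)$ for $k\ge1$. *)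

(* Defs.v *)
From Stdlib Require Import Reals List.
From Coquelicot Require Import Coquelicot.
Open Scope R_scope.

(* Three-term Legendre-type recurrence:
   (k+1) X_{k+1}(t) = (2k+1) t X_k(t) - k X_{k-1}(t),  k >= 1.
   three_term m t x0 x1 = (X_m(t), X_{m+1}(t)) given X_0 = x0, X_1 = x1. *)
Fixpoint three_term (m : nat) (t x0 x1 : R) : R * R :=
  match m with
  | O => (x0, x1)
  | S m' =>
      let (a, b) := three_term m' t x0 x1 in
      (b, ((2 * INR m' + 3) * t * b - (INR m' + 1) * a) / (INR m' + 2))
  end.

Definition legendreP (k : nat) (t : R) : R := fst (three_term k t 1 t).

Definition legQ0 (t : R) : R := / 2 * ln ((1 + t) / (1 - t)).
Definition legQ1 (t : R) : R := t / 2 * ln ((1 + t) / (1 - t)) - 1.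
Definition legendreQ (k : nat) (t : R) : R := fst (three_term k t (legQ0 t) (legQ1 t)).

(* The finite Fourier transform F_c[phi](x) = int_{-1}^1 phi(t) e^{icxt} dt
   acting on a real function phi has real part int phi(t) cos(cxt) dt and
   imaginary part int phi(t) sin(cxt) dt.  "F_c[phi] = (a + i b) phi on [-1,1]"
   for real phi. *)
Definition fc_eigen (c : R) (phi : R -> R) (a b : R) : Prop :=
  ex_RInt phi (-1) 1 /\
  forall x, -1 <= x <= 1 ->
    RInt (fun t => phi t * cos (c * x * t)) (-1) 1 = a * phi x /\
    RInt (fun t => phi t * sin (c * x * t)) (-1) 1 = b * phi x.

Definition fc_eigenvalue (c a b : R) : Prop :=
  exists phi : R -> R, fc_eigen c phi a b /\
    exists x, -1 <= x <= 1 /\ phi x <> 0.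

(* psi is the n-th prolate spheroidal wave function of band limit c:
   a real, L^2[-1,1]-normalized eigenfunction of F_c whose eigenvalue
   a + i b is preceded (in decreasing order of absolute value) by exactly n
   eigenvalues of F_c. *)
Definition is_pswf (c : R) (n : nat) (psi : R -> R) : Prop :=
  exists a b : R,
    fc_eigen c psi a b /\
    RInt (fun t => psi t ^ 2) (-1) 1 = 1 /\
    exists l : list (R * R),
      NoDup l /\ length l = n /\
      forall a' b', In (a', b') l <->
        (fc_eigenvalue c a' b' /\ a' ^ 2 + b' ^ 2 > a ^ 2 + b ^ 2).

Definition legendre_coef (psi : R -> R) (k : nat) : R :=
  (INR k + / 2) * RInt (fun x => psi x * legendreP k x) (-1) 1.

(* Main.v *)
(** Put [g x = psi x / (t - x)], where [t] is a zero of [psi]. The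
    Christoffel-Darboux formula for the mixed kernel
    [sum_(k <= N) (2k+1) P_k(x) Q_k(t)] gives
    [sum_(k <= N) alpha_k Q_k(t) = 1/2 int g
      + (N+1)/2 (Q_{N+1}(t) int P_N g - Q_N(t) int P_{N+1} g)].
    The three-term recurrence bounds [P_N] and [Q_N] by [O(3^N)], while
    [int P_N g] is [O((3c)^N / N!)]: if the eigenvalue is nonzero, then [psi] is
    the transform of itself under a bounded trigonometric kernel, whose Taylor
    polynomials yield polynomials of degree less than [N] that are
    [O(c^N / N!)]-close to [g] and are orthogonal to [P_N]. If the eigenvalue is
    zero, all moments of [psi] vanish, which forces [int psi^2 = 0] and
    contradicts the normalization. *)

Require Import Defs.
From Stdlib Require Import Reals Arith Factorial Lra Lia List.
From Coquelicot Require Import Coquelicot.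
Open Scope R_scope.

(** * Legendre polynomials and Legendre functions of the second kind *)

(** [psi] is only assumed Riemann integrable, so any regularity has to come from the eigenvalue
    equation. When the eigenvalue is nonzero, dividing by it exhibits [psi] on [-1,1] as an entire
    function, and factorial decay beats every exponential: this is why 3^N, far from sharp for both
    kinds of Legendre functions, is good enough and no asymptotics are needed. Since [g] is a
    quotient, a uniform approximation of [psi] alone would be lost near [t]; the Taylor remainder is
    therefore controlled in Lipschitz form, which makes division by x - t free. When the eigenvalue
    is zero, nothing makes [psi] continuous, so it cannot be approximated uniformly by polynomials.
    Instead, explicit polynomials approximate indicators of intervals; this gives vanishing
    integrals over all subintervals, hence orthogonality to step functions, and these approximate
    [psi] in the mean by the very definition of Riemann integrability. *)

Lemma three_term_snd (m : nat) (t x0 x1 : R) :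
  snd (three_term m t x0 x1) = fst (three_term (S m) t x0 x1).
Proof. simpl; destruct (three_term m t x0 x1); reflexivity. Qed.

Lemma three_term_rec (m : nat) (t x0 x1 : R) :
  (INR m + 2) * fst (three_term (S (S m)) t x0 x1) =
  (2 * INR m + 3) * t * fst (three_term (S m) t x0 x1)
  - (INR m + 1) * fst (three_term m t x0 x1).
Proof.
  assert (Hm := pos_INR m).
  rewrite <- (three_term_snd (S m)), <- (three_term_snd m); simpl.
  destruct (three_term m t x0 x1); simpl; field; lra.
Qed.

(** The growth factor 3 works because (2m+3)|t|/(m+2) <= 2 and (m+1)/(m+2) <= 1, while 2*3 + 1 <= 9.
    The hypotheses on [x0] and [x1] are shaped to serve both kinds of Legendre functions. *)
Lemma three_term_bound (m : nat) (t x0 x1 C : R) :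
  -1 <= t <= 1 -> Rabs x0 <= C -> Rabs x1 <= 3 * C ->
  Rabs (fst (three_term m t x0 x1)) <= C * 3 ^ m.
Proof.
  intros Ht H0 H1.
  assert (HC : 0 <= C) by (assert (h := Rabs_pos x0); lra).
  enough (Rabs (fst (three_term m t x0 x1)) <= C * 3 ^ m /\
          Rabs (fst (three_term (S m) t x0 x1)) <= C * 3 ^ S m) by tauto.
  induction m as [|m [IH IH']]; [simpl; lra|split; [exact IH'|]].
  assert (Hm := pos_INR m).
  assert (E := three_term_rec m t x0 x1).
  remember (fst (three_term (S (S m)) t x0 x1)) as z eqn:Ez; clear Ez.
  remember (fst (three_term (S m) t x0 x1)) as y eqn:Ey; clear Ey.
  remember (fst (three_term m t x0 x1)) as x eqn:Ex; clear Ex.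
  simpl in IH' |- *.
  remember (C * 3 ^ m) as B eqn:EB.
  replace (C * (3 * (3 * 3 ^ m))) with (9 * B) by (subst; ring).
  replace (C * (3 * 3 ^ m)) with (3 * B) in IH' by (subst; ring).
  assert (Rabs (t * y) <= 3 * B).
  { rewrite Rabs_mult. assert (Rabs t <= 1) by (apply Rabs_le; lra).
    assert (h := Rabs_pos y); assert (h' := Rabs_pos t); nra. }
  apply Rabs_le_between in IH. apply Rabs_le_between in H.
  apply Rabs_le; split; nra.
Qed.

Lemma legendreP_rec (k : nat) (x : R) :
  (INR k + 2) * legendreP (S (S k)) x =
  (2 * INR k + 3) * x * legendreP (S k) x - (INR k + 1) * legendreP k x.
Proof. apply three_term_rec. Qed.

Lemma legendreQ_rec (k : nat) (x : R) :
  (INR k + 2) * legendreQ (S (S k)) x =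
  (2 * INR k + 3) * x * legendreQ (S k) x - (INR k + 1) * legendreQ k x.
Proof. apply three_term_rec. Qed.

Lemma legendreP_SS (k : nat) (x : R) :
  legendreP (S (S k)) x =
  ((2 * INR k + 3) * x * legendreP (S k) x - (INR k + 1) * legendreP k x)
  / (INR k + 2).
Proof.
  rewrite <- legendreP_rec; field; assert (h := pos_INR k); lra.
Qed.

Lemma nat_ind2 (A : nat -> Prop) :
  A 0%nat -> A 1%nat -> (forall k, A k -> A (S k) -> A (S (S k))) ->
  forall k, A k.
Proof.
  intros H0 H1 HS k; enough (A k /\ A (S k)) by tauto.
  induction k as [|k [IH IH']]; auto.
Qed.

Lemma legendreP_bound (k : nat) (x : R) :
  -1 <= x <= 1 -> Rabs (legendreP k x) <= 3 ^ k.
Proof.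
  intros Hx; rewrite <- (Rmult_1_l (3 ^ k)).
  apply three_term_bound; [exact Hx | rewrite Rabs_R1; lra |].
  apply Rabs_le; lra.
Qed.

Lemma legendreQ_bound (t : R) :
  -1 < t < 1 -> exists C, 0 <= C /\ forall k, Rabs (legendreQ k t) <= C * 3 ^ k.
Proof.
  intros Ht; exists (Rmax (Rabs (legQ0 t)) (Rabs (legQ1 t))).
  assert (h := Rmax_l (Rabs (legQ0 t)) (Rabs (legQ1 t))).
  assert (h' := Rmax_r (Rabs (legQ0 t)) (Rabs (legQ1 t))).
  assert (p := Rabs_pos (legQ0 t)).
  split; [lra|]; intros k; apply three_term_bound; lra.
Qed.

Lemma ex_derive_legendreP (k : nat) (x : R) : ex_derive (legendreP k) x.
Proof.
  induction k as [| |k IH IH'] using nat_ind2.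
  - exact (ex_derive_const 1 x).
  - exact (ex_derive_id x).
  - eapply ex_derive_ext; [intros y; symmetry; apply legendreP_SS|].
    auto_derive; repeat split; auto.
Qed.

Lemma continuous_legendreP (k : nat) (x : R) : continuous (legendreP k) x.
Proof. apply (ex_derive_continuous (legendreP k)), ex_derive_legendreP. Qed.

Lemma Derive_legendreP_SS (k : nat) (x : R) :
  (INR k + 2) * Derive (legendreP (S (S k))) x =
  (2 * INR k + 3) * (legendreP (S k) x + x * Derive (legendreP (S k)) x)
  - (INR k + 1) * Derive (legendreP k) x.
Proof.
  rewrite (Derive_ext _ _ _ (legendreP_SS k)).
  match goal with |- context [Derive ?F x] =>
    assert (D : is_derive F x (((2 * INR k + 3) *
      (legendreP (S k) x + x * Derive (legendreP (S k)) x)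
      - (INR k + 1) * Derive (legendreP k) x) / (INR k + 2))) end.
  { auto_derive; [repeat split; apply ex_derive_legendreP|].
    change (Derive (fun y => legendreP (S k) y) x) with (Derive (legendreP (S k)) x).
    change (Derive (fun y => legendreP k y) x) with (Derive (legendreP k) x).
    field; assert (h := pos_INR k); lra. }
  rewrite (is_derive_unique _ _ _ D); field; assert (h := pos_INR k); lra.
Qed.

(** The relations are proved jointly because the induction step needs both. Adding the second one at
    k + 1 to the first one at k cancels the terms with factor x and leaves P_{k+2}' - P_k'. *)
Lemma legendreP_derive_rel (k : nat) (x : R) :
  x * Derive (legendreP (S k)) x - Derive (legendreP k) x
    = (INR k + 1) * legendreP (S k) x /\
  Derive (legendreP (S k)) x - x * Derive (legendreP k) x
    = (INR k + 1) * legendreP k x.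
Proof.
  induction k as [|k [IA IB]].
  - change (legendreP 1) with (fun y : R => y).
    change (legendreP 0) with (fun _ : R => 1).
    rewrite Derive_const, Derive_id; simpl; lra.
  - rewrite S_INR.
    assert (h := pos_INR k).
    assert (E := Derive_legendreP_SS k x).
    assert (F := legendreP_rec k x).
    remember (Derive (legendreP (S (S k))) x) as d2.
    remember (Derive (legendreP (S k)) x) as d1.
    remember (Derive (legendreP k) x) as d0.
    remember (legendreP (S (S k)) x) as p2.
    remember (legendreP (S k) x) as p1.
    remember (legendreP k x) as p0.
    assert (B : d2 - x * d1 = (INR k + 1 + 1) * p1).
    { apply (Rmult_eq_reg_l (INR k + 2)); [|lra].
      replace d0 with (x * d1 - (INR k + 1) * p1) in E by lra.
      ring_simplify; ring_simplify in E; lra. }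
    split; [|exact B].
    replace d2 with (x * d1 + (INR k + 1 + 1) * p1) by lra.
    replace ((INR k + 1 + 1) * p2) with ((INR k + 2) * p2) by ring.
    rewrite F.
    assert (x * (x * d1 - d0) - (d1 - x * d0) =
            x * ((INR k + 1) * p1) - (INR k + 1) * p0) by (rewrite IA, IB; ring).
    ring_simplify in H; ring_simplify; lra.
Qed.

Lemma is_derive_legendreP_diff (k : nat) (x : R) :
  is_derive (fun y => legendreP (S (S k)) y - legendreP k y) x
    ((2 * INR k + 3) * legendreP (S k) x).
Proof.
  auto_derive; [repeat split; apply ex_derive_legendreP|].
  change (Derive (fun y => legendreP k y) x) with (Derive (legendreP k) x).
  change (Derive (fun y => legendreP (S (S k)) y) x)
    with (Derive (legendreP (S (S k))) x).
  destruct (legendreP_derive_rel (S k) x) as [_ H].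
  destruct (legendreP_derive_rel k x) as [H' _].
  rewrite S_INR in H; lra.
Qed.

Lemma legendreP_1 (k : nat) : legendreP k 1 = 1.
Proof.
  induction k as [| |k IH IH'] using nat_ind2; [reflexivity..|].
  rewrite legendreP_SS, IH, IH'; field; assert (h := pos_INR k); lra.
Qed.

Lemma legendreP_m1 (k : nat) : legendreP k (-1) = (-1) ^ k.
Proof.
  induction k as [| |k IH IH'] using nat_ind2; [reflexivity|unfold legendreP; simpl; ring|].
  rewrite legendreP_SS, IH, IH'; simpl; field; assert (h := pos_INR k); lra.
Qed.

Lemma continuous_monomial (j : nat) (x : R) : continuous (fun y : R => y ^ j) x.
Proof. apply @ex_derive_continuous; auto_derive; trivial. Qed.

(* Integrating by parts against [P_{k+2} - P_k], which vanishes at both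
   endpoints, lowers both the degree of the Legendre polynomial and that of the
   monomial by one. *)
Lemma legendreP_orthogonal (j k : nat) :
  (j < k)%nat -> RInt (fun x => legendreP k x * x ^ j) (-1) 1 = 0.
Proof.
  revert k; induction j as [|j IH]; intros [|k] Hjk; try lia;
    assert (h := pos_INR k).
  - assert (D := is_RInt_derive _ _ (-1) 1
      (fun x _ => is_derive_legendreP_diff k x)).
    assert (D' : is_RInt (fun x => (2 * INR k + 3) * legendreP (S k) x) (-1) 1 0).
    { evar_last; [apply D|].
      - intros x _; apply (continuous_scal_r (2 * INR k + 3) (legendreP (S k))).
        apply continuous_legendreP.
      - rewrite !legendreP_1, !legendreP_m1; unfold minus, plus, opp; simpl; ring. }
    apply (is_RInt_scal _ _ _ (/ (2 * INR k + 3))) in D'.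
    apply is_RInt_unique.
    replace 0 with (scal (/ (2 * INR k + 3)) 0) by apply Rmult_0_r.
    eapply is_RInt_ext; [|exact D']; intros x _; unfold scal; simpl; unfold mult; simpl.
    field; lra.
  - assert (E : is_RInt (fun x => (2 * INR k + 3) * (legendreP (S k) x * x ^ S j)
        + (INR (S j)) * (legendreP (S (S k)) x * x ^ j - legendreP k x * x ^ j))
        (-1) 1 0).
    { evar_last; [apply (is_RInt_derive
        (fun x => (legendreP (S (S k)) x - legendreP k x) * x ^ S j))|].
      - intros x _; evar_last.
        + apply @is_derive_mult; [apply is_derive_legendreP_diff| |intros; apply Rmult_comm].
          apply is_derive_pow, is_derive_id.
        + unfold plus, mult, one; simpl pred; simpl; ring.
      - intros x _.
        assert (c1 := fun k => continuous_legendreP k x).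
        apply @continuous_plus; apply @continuous_mult;
          try apply continuous_const.
        + apply @continuous_mult; [apply c1|apply continuous_monomial].
        + apply @continuous_minus; apply @continuous_mult;
            first [apply c1|apply continuous_monomial].
      - rewrite !legendreP_1, !legendreP_m1; unfold minus, plus, opp; simpl; ring. }
    assert (X : forall i m, ex_RInt (fun x => legendreP i x * x ^ m) (-1) 1).
    { intros i m; apply @ex_RInt_continuous; intros x _.
      apply @continuous_mult; [apply continuous_legendreP|apply continuous_monomial]. }
    (* The same integral split by linearity: the induction hypothesis removes both terms with x^j,
       so 2k+3 times the wanted integral is 0. *)
    assert (E' := is_RInt_plus _ _ _ _ _ _
      (is_RInt_scal _ _ _ (2 * INR k + 3) _ (RInt_correct _ _ _ (X (S k) (S j))))
      (is_RInt_scal _ _ _ (INR (S j)) _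
        (is_RInt_minus _ _ _ _ _ _ (RInt_correct _ _ _ (X (S (S k)) j))
                                   (RInt_correct _ _ _ (X k j))))).
    apply (is_RInt_unique (V := R_CompleteNormedModule)) in E.
    apply (is_RInt_unique (V := R_CompleteNormedModule)) in E'.
    assert (E2 := eq_trans (eq_sym E') E); clear E E'.
    rewrite (IH (S (S k))), (IH k) in E2 by lia.
    unfold plus, scal, minus, opp, plus, mult in E2; simpl in E2; unfold mult in E2; simpl in E2.
    rewrite Ropp_0, Rplus_0_r, Rmult_0_r, Rplus_0_r in E2.
    apply Rmult_integral in E2; destruct E2 as [E2|E2]; [lra|exact E2].
Qed.

Lemma sum_n_Rsucc (u : nat -> R) (n : nat) :
  sum_n u (S n) = sum_n u n + u (S n).
Proof. exact (sum_Sn u n). Qed.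

(** The term 1 comes from the initial values, Q_1 = t Q_0 - 1 against P_1 = x P_0. It persists for
    every [N] and is the source of the integral in the final formula. The identity is purely
    algebraic and includes x = t. *)
Lemma christoffel_darboux (N : nat) (x t : R) :
  (t - x) * sum_n (fun k => (2 * INR k + 1) * (legendreP k x * legendreQ k t)) N =
  1 + (INR N + 1) * (legendreP N x * legendreQ (S N) t
                     - legendreP (S N) x * legendreQ N t).
Proof.
  induction N as [|N IH].
  - rewrite sum_O; unfold legendreP, legendreQ; simpl; unfold legQ0, legQ1.
    field_simplify; [|lra..]; lra.
  - rewrite sum_n_Rsucc, Rmult_plus_distr_l, IH, S_INR.
    assert (F := legendreP_rec N x); assert (G := legendreQ_rec N t).
    remember (legendreP (S (S N)) x) as p2; remember (legendreP (S N) x) as p1.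
    remember (legendreQ (S (S N)) t) as q2; remember (legendreQ (S N) t) as q1.
    replace ((INR N + 1 + 1) * (p1 * q2 - p2 * q1))
      with (p1 * ((INR N + 2) * q2) - q1 * ((INR N + 2) * p2)) by ring.
    rewrite F, G; ring.
Qed.

(** * Riemann integrals of real functions *)

(* Coquelicot states equalities in the carrier of a normed module, where [ring]
   and [field] do not recognize the type [R]. *)
Ltac real_eq := match goal with |- @eq _ ?x ?y => change (@eq R x y) end.

Lemma ex_RInt_Rplus (f g : R -> R) (a b : R) :
  ex_RInt f a b -> ex_RInt g a b -> ex_RInt (fun x => f x + g x) a b.
Proof. apply @ex_RInt_plus. Qed.

Lemma ex_RInt_Rminus (f g : R -> R) (a b : R) :
  ex_RInt f a b -> ex_RInt g a b -> ex_RInt (fun x => f x - g x) a b.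
Proof. apply @ex_RInt_minus. Qed.

Lemma ex_RInt_Rscal (f : R -> R) (a b l : R) :
  ex_RInt f a b -> ex_RInt (fun x => l * f x) a b.
Proof. apply @ex_RInt_scal. Qed.

Lemma RInt_Rplus (f g : R -> R) (a b : R) :
  ex_RInt f a b -> ex_RInt g a b ->
  RInt (fun x => f x + g x) a b = RInt f a b + RInt g a b.
Proof. apply (RInt_plus (V := R_CompleteNormedModule)). Qed.

Lemma RInt_Rminus (f g : R -> R) (a b : R) :
  ex_RInt f a b -> ex_RInt g a b ->
  RInt (fun x => f x - g x) a b = RInt f a b - RInt g a b.
Proof. apply (RInt_minus (V := R_CompleteNormedModule)). Qed.

Lemma RInt_Rscal (f : R -> R) (a b l : R) :
  ex_RInt f a b -> RInt (fun x => l * f x) a b = l * RInt f a b.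
Proof. apply (RInt_scal (V := R_CompleteNormedModule)). Qed.

Lemma RInt_RChasles (f : R -> R) (a b c : R) :
  ex_RInt f a b -> ex_RInt f b c -> RInt f a c = RInt f a b + RInt f b c.
Proof. intros H H'; symmetry; exact (RInt_Chasles f a b c H H'). Qed.

Lemma is_RInt_sum_n (f : nat -> R -> R) (a b : R) (n : nat) :
  (forall k, (k <= n)%nat -> ex_RInt (f k) a b) ->
  is_RInt (fun x => sum_n (fun k => f k x) n) a b
    (sum_n (fun k => RInt (f k) a b) n).
Proof.
  induction n as [|n IH]; intros H.
  - rewrite sum_O; apply is_RInt_ext with (f 0%nat);
      [intros x _; symmetry; apply (sum_O (fun k => f k x))|].
    apply (RInt_correct (V := R_CompleteNormedModule)); auto.
  - rewrite sum_Sn.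
    apply is_RInt_ext with (fun x => plus (sum_n (fun k => f k x) n) (f (S n) x));
      [intros x _; symmetry; apply (sum_Sn (fun k => f k x))|].
    apply (is_RInt_plus (V := R_NormedModule)); [apply IH; auto|].
    apply (RInt_correct (V := R_CompleteNormedModule)); auto.
Qed.

(** * Products and uniform limits of Riemann integrable functions *)

Lemma IsStepFun_comp (h f : R -> R) (a b : R) :
  IsStepFun f a b -> IsStepFun (fun x => h (f x)) a b.
Proof.
  intros [l [lf (H1 & H2 & H3 & H4 & H5)]].
  exists l; exists (map h lf); repeat split; auto.
  - rewrite length_map; exact H4.
  - intros i Hi x Hx; rewrite (H5 i Hi x Hx).
    assert (Hl : (i < length lf)%nat) by lia.
    clear -Hl; revert i Hl; induction lf as [|y lf IH]; intros i Hl; simpl in *; [lia|].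
    destruct i; simpl; [reflexivity|apply IH; lia].
Qed.

(** Applying [h] to a step function close to [f] yields a step function close to the composite, with
    the error multiplied by at most [L]. *)
Lemma ex_RInt_lipschitz_comp (h f : R -> R) (L a b : R) :
  (forall y z, Rabs (h y - h z) <= L * Rabs (y - z)) ->
  ex_RInt f a b -> ex_RInt (fun x => h (f x)) a b.
Proof.
  intros Hh Hf; apply ex_RInt_Reals_1; apply ex_RInt_Reals_0 in Hf.
  assert (HL : 0 <= L).
  { specialize (Hh 1 0); assert (p := Rabs_pos (h 1 - h 0)).
    rewrite Rminus_0_r, Rabs_R1 in Hh; lra. }
  intros eps.
  assert (He : 0 < eps / (L + 1)) by (apply Rdiv_lt_0_compat; [apply cond_pos|lra]).
  destruct (Hf (mkposreal _ He)) as [phi [psi [H1 H2]]]; simpl in H2.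
  exists (mkStepFun (IsStepFun_comp h phi a b (pre phi))).
  (* This is 0 + L psi, the error-dominating step function scaled by [L]. Dividing [eps] by L + 1
     instead of L covers L = 0. *)
  exists (mkStepFun (StepFun_P28 L (mkStepFun (StepFun_P4 a b 0)) psi)).
  split.
  - intros t Ht; simpl; unfold fct_cte; rewrite Rplus_0_l.
    eapply Rle_trans; [apply Hh|apply Rmult_le_compat_l; [exact HL|auto]].
  - rewrite StepFun_P30, StepFun_P18, Rmult_0_l, Rplus_0_l, Rabs_mult.
    rewrite (Rabs_pos_eq L HL).
    apply Rle_lt_trans with (L * (eps / (L + 1))).
    + apply Rmult_le_compat_l; lra.
    + assert (p := cond_pos eps).
      apply Rmult_lt_reg_r with (L + 1); [lra|].
      field_simplify; [nra|lra].
Qed.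

Lemma ex_RInt_square (f : R -> R) (a b : R) :
  ex_RInt f a b -> ex_RInt (fun x => f x * f x) a b.
Proof.
  intros Hf; destruct (ex_RInt_ub f a b Hf) as [M HM].
  change (norm (V := R_NormedModule)) with Rabs in HM.
  (* Squaring is not Lipschitz on the whole line. Clamping to [-M, M] leaves the values of [f]
     unchanged and makes it 2M-Lipschitz. *)
  pose (cl y := Rmax (- M) (Rmin M y)).
  destruct (Rlt_le_dec M 0) as [Mneg|Mpos].
  { exfalso. specialize (HM (Rmin a b)); assert (p := Rabs_pos (f (Rmin a b))).
    assert (q := Rmin_l a b); assert (q' := Rmax_l a b); lra. }
  apply ex_RInt_ext with (fun x => cl (f x) * cl (f x)).
  { intros x Hx; assert (HMx : Rabs (f x) <= M) by (apply HM; lra).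
    apply Rabs_le_between in HMx; unfold cl.
    rewrite Rmin_right by lra; rewrite Rmax_right by lra; reflexivity. }
  apply (ex_RInt_lipschitz_comp (fun y => cl y * cl y) f (2 * M)); [|exact Hf].
  assert (B : forall y, - M <= cl y <= M).
  { intros y; unfold cl, Rmax, Rmin; repeat destruct Rle_dec; lra. }
  intros y z; replace (cl y * cl y - cl z * cl z)
    with ((cl y + cl z) * (cl y - cl z)) by ring.
  rewrite Rabs_mult; apply Rmult_le_compat; try apply Rabs_pos.
  - assert (By := B y); assert (Bz := B z); apply Rabs_le; lra.
  - unfold cl, Rmax, Rmin, Rabs; repeat destruct Rle_dec; repeat destruct Rcase_abs; lra.
Qed.

(** Polarization reduces products to squares. *)
Lemma ex_RInt_Rmult (f g : R -> R) (a b : R) :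
  ex_RInt f a b -> ex_RInt g a b -> ex_RInt (fun x => f x * g x) a b.
Proof.
  intros Hf Hg.
  apply ex_RInt_ext with (fun x => / 4 * ((f x + g x) * (f x + g x)
    - (f x - g x) * (f x - g x))); [intros; real_eq; field|].
  apply ex_RInt_Rscal, ex_RInt_Rminus;
    [apply (ex_RInt_square (fun x => f x + g x)), ex_RInt_Rplus
    |apply (ex_RInt_square (fun x => f x - g x)), ex_RInt_Rminus]; assumption.
Qed.

Lemma ex_RInt_Rabs (f : R -> R) (a b : R) :
  ex_RInt f a b -> ex_RInt (fun x => Rabs (f x)) a b.
Proof. apply ex_RInt_norm. Qed.

Lemma RInt_Rabs_le (f g : R -> R) (a b : R) :
  a <= b -> ex_RInt f a b -> ex_RInt g a b ->
  (forall x, a < x < b -> Rabs (f x) <= g x) -> Rabs (RInt f a b) <= RInt g a b.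
Proof.
  intros Hab Hf Hg H; eapply Rle_trans; [apply abs_RInt_le; assumption|].
  apply RInt_le; [assumption|apply ex_RInt_Rabs; assumption|assumption..].
Qed.

Lemma RInt_Rabs_le_const (f : R -> R) (a b M : R) :
  a <= b -> ex_RInt f a b -> (forall x, a < x < b -> Rabs (f x) <= M) ->
  Rabs (RInt f a b) <= M * (b - a).
Proof.
  intros Hab Hf H; replace (M * (b - a)) with (RInt (fun _ => M) a b).
  - apply RInt_Rabs_le; [assumption..|apply ex_RInt_const|assumption].
  - rewrite RInt_const; apply Rmult_comm.
Qed.

(** The bound is required only inside the interval, so that an endpoint may be the zero [t], where
    [psi x / (t - x)] divides by 0. *)
Lemma ex_RInt_uniform_limit (q : nat -> R -> R) (d : nat -> R) (g : R -> R) (a b : R) :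
  a <= b -> (forall n, ex_RInt (q n) a b) ->
  (forall n x, a < x < b -> Rabs (g x - q n x) <= d n) ->
  is_lim_seq d 0 -> ex_RInt g a b.
Proof.
  intros Hab Hq Hd Hlim.
  (* The limit theorem asks for closeness on the whole line; outside (a, b) each approximant is
     replaced by [g], which does not affect its integral. *)
  pose (f n x := if Rlt_dec a x then if Rlt_dec x b then q n x else g x else g x).
  assert (Hf : forall n, is_RInt (f n) a b (RInt (q n) a b)).
  { intros n; apply is_RInt_ext with (q n).
    - rewrite Rmin_left, Rmax_right by lra; intros x Hx; unfold f.
      destruct Rlt_dec; [|lra]; destruct Rlt_dec; [reflexivity|lra].
    - apply (RInt_correct (V := R_CompleteNormedModule)), Hq. }
  destruct (filterlim_RInt f a b eventually _ g _ Hf) as [I [_ HI]].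
  - intros P [eps HP].
    apply is_lim_seq_spec in Hlim; destruct (Hlim eps) as [N HN].
    exists N; intros n Hn; apply HP; intros x.
    specialize (HN n Hn); rewrite Rminus_0_r in HN.
    apply ball_sym.
    change (Rabs (g x - f n x) < eps); unfold f.
    assert (p := cond_pos eps).
    destruct Rlt_dec; [destruct Rlt_dec|];
      [|rewrite Rminus_diag, Rabs_R0; exact p..].
    assert (X := Hd n x (conj r r0)); assert (Y := Rle_abs (d n)); lra.
  - exists I; exact HI.
Qed.

(** On each piece [phi] is constant, so only the mean value [z] of [f] enters. With f = 1 and z = 1
    this identifies the two notions of integral of a step function; with z = 0 it gives
    orthogonality to all step functions. *)
Lemma is_RInt_stepfun_mult (f phi : R -> R) (l lf : list R) (a b z : R) :
  a <= b ->
  (forall u v, a <= u -> u <= v -> v <= b -> is_RInt f u v (z * (v - u))) ->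
  adapted_couple phi a b l lf ->
  is_RInt (fun x => f x * phi x) a b (z * Int_SF lf l).
Proof.
  revert a lf; induction l as [|r1 l IH]; intros a lf Hab Hf Hc.
  { destruct Hc as (_ & _ & _ & H & _); discriminate H. }
  destruct l as [|r2 l].
  { destruct Hc as (_ & H1 & H2 & H3 & _); simpl in H1, H2.
    rewrite Rmin_left in H1 by lra; rewrite Rmax_right in H2 by lra.
    destruct lf; [|discriminate H3].
    replace b with a by congruence; simpl; rewrite Rmult_0_r.
    apply (is_RInt_point (V := R_NormedModule)). }
  destruct lf as [|r3 lf].
  { destruct Hc as (_ & _ & _ & H & _); discriminate H. }
  assert (Hc' := StepFun_P7 Hab Hc).
  destruct Hc as (H1 & H2 & H3 & H4 & H5).
  assert (E1 : r1 = a) by (simpl in H2; rewrite Rmin_left in H2; lra); subst r1.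
  assert (a <= r2) by (apply (H1 0%nat); simpl; lia).
  assert (r2 <= b).
  { destruct Hc' as (O1 & _).
    assert (Hb : RList.pos_Rl (a :: r2 :: l) (pred (length (a :: r2 :: l))) = b)
      by (rewrite H3; apply Rmax_right; lra).
    rewrite <- Hb.
    change (r2 <= RList.pos_Rl (r2 :: l) (pred (length (r2 :: l)))).
    apply (RList.RList_P7 (r2 :: l) r2 O1); simpl; tauto. }
  assert (D := IH r2 lf ltac:(lra) ltac:(intros; apply Hf; lra) Hc').
  replace (z * Int_SF (r3 :: lf) (a :: r2 :: l))
    with (plus (r3 * (z * (r2 - a))) (z * Int_SF lf (r2 :: l)))
    by (unfold plus; simpl; ring).
  apply (is_RInt_Chasles (V := R_NormedModule) _ _ r2); [|exact D].
  apply is_RInt_ext with (fun x => r3 * f x).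
  { rewrite Rmin_left, Rmax_right by lra; intros x Hx.
    rewrite (H5 0%nat ltac:(simpl; lia) x Hx); apply Rmult_comm. }
  apply (is_RInt_scal (V := R_NormedModule)), Hf; lra.
Qed.

Lemma is_RInt_StepFun (a b : R) (phi : StepFun a b) :
  a <= b -> is_RInt phi a b (RiemannInt_SF phi).
Proof.
  intros Hab; unfold RiemannInt_SF; destruct Rle_dec; [|lra].
  rewrite <- (Rmult_1_l (Int_SF _ _)).
  apply is_RInt_ext with (fun x => 1 * phi x); [intros; apply Rmult_1_l|].
  apply (is_RInt_stepfun_mult (fun _ => 1)); [exact Hab| |apply StepFun_P1].
  intros u v _ _ _; rewrite Rmult_comm.
  apply (is_RInt_const (V := R_NormedModule)).
Qed.

(** As [f] is orthogonal to every step function [phi], the integral of f^2 equals that of f (f -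
    phi), which is bounded by M times the mean error of [phi]. *)
Lemma RInt_square_zero (f : R -> R) (a b : R) :
  a <= b -> ex_RInt f a b ->
  (forall u v, a <= u -> u <= v -> v <= b -> RInt f u v = 0) ->
  RInt (fun x => f x * f x) a b = 0.
Proof.
  intros Hab Hf H0; assert (Hf' := ex_RInt_Reals_0 _ _ _ Hf).
  destruct (ex_RInt_ub f a b Hf) as [M HM].
  change (norm (V := R_NormedModule)) with Rabs in HM.
  rewrite Rmin_left, Rmax_right in HM by lra.
  assert (Mpos : 0 <= M).
  { apply Rle_trans with (Rabs (f a)); [apply Rabs_pos|apply HM; lra]. }
  apply cond_eq; intros eps Heps; rewrite Rminus_0_r.
  assert (He : 0 < eps / (M + 1)) by (apply Rdiv_lt_0_compat; lra).
  destruct (Hf' (mkposreal _ He)) as [phi [theta [H1 H2]]]; simpl in H2.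
  rewrite Rmin_left, Rmax_right in H1 by lra.
  assert (Hphi : is_RInt (fun x => f x * phi x) a b 0).
  { rewrite <- (Rmult_0_l (Int_SF (subdivision_val phi) (subdivision phi))).
    apply is_RInt_stepfun_mult; [exact Hab| |apply StepFun_P1].
    intros u v Hu Huv Hv; rewrite Rmult_0_l, <- (H0 u v Hu Huv Hv).
    apply (RInt_correct (V := R_CompleteNormedModule)).
    apply (ex_RInt_Chasles_1 (V := R_CompleteNormedModule)) with b; [lra|].
    apply (ex_RInt_Chasles_2 (V := R_CompleteNormedModule)) with a; [lra|exact Hf]. }
  assert (Htheta := is_RInt_StepFun a b theta Hab).
  assert (Hphi' : ex_RInt phi a b)
    by (eexists; apply (is_RInt_StepFun a b phi Hab)).
  assert (Hd : ex_RInt (fun x => f x - phi x) a b)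
    by (apply ex_RInt_Rminus; assumption).
  replace (RInt (fun x => f x * f x) a b)
    with (RInt (fun x => f x * (f x - phi x)) a b).
  - apply Rle_lt_trans with (RInt (fun x => M * theta x) a b).
    + apply RInt_Rabs_le; [exact Hab|apply ex_RInt_Rmult; assumption| |].
      * apply ex_RInt_Rscal; eexists; exact Htheta.
      * intros x Hx; rewrite Rabs_mult.
        apply Rmult_le_compat; try apply Rabs_pos; [apply HM|apply H1]; lra.
    + rewrite RInt_Rscal by (eexists; exact Htheta).
      rewrite (is_RInt_unique _ _ _ _ Htheta).
      assert (p := Rle_abs (RiemannInt_SF theta)).
      apply Rle_lt_trans with (M * (eps / (M + 1))).
      * apply Rmult_le_compat_l; lra.
      * apply Rmult_lt_reg_r with (M + 1); [lra|].
        field_simplify; [nra|lra].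
  - rewrite (RInt_ext _ (fun x => f x * f x - f x * phi x)) by (intros; apply Rmult_minus_distr_l).
    rewrite RInt_Rminus by (apply ex_RInt_Rmult; assumption).
    rewrite (is_RInt_unique _ _ _ _ Hphi); apply Rminus_0_r.
Qed.

(** * Taylor approximation of the trigonometric transform *)

Lemma continuous_of_ex_derive (f : R -> R) (x : R) : ex_derive f x -> continuous f x.
Proof. apply (ex_derive_continuous f). Qed.

Lemma ex_RInt_of_ex_derive (f : R -> R) (a b : R) :
  (forall x, ex_derive f x) -> ex_RInt f a b.
Proof.
  intros H; apply (ex_RInt_continuous (V := R_CompleteNormedModule)).
  intros x _; apply continuous_of_ex_derive, H.
Qed.

(** For A - iB = 1/lambda this is the real part of e^{iy}/lambda: one real kernel, in a family
    closed under differentiation, replaces the pair of cosine and sine equations. *)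
Definition trig (A B y : R) : R := A * cos y + B * sin y.

(* Differentiating [trig A B] gives [trig B (- A)]; [trig_coef m A B] is the
   [m]-th derivative of [trig A B] at 0. *)
Fixpoint trig_coef (m : nat) (A B : R) : R :=
  match m with
  | O => A
  | S m' => trig_coef m' B (- A)
  end.

Definition trig_taylor (N : nat) (A B y : R) : R :=
  sum_n (fun m => trig_coef m A B / INR (fact m) * y ^ m) N.

Lemma is_derive_trig (A B y : R) : is_derive (trig A B) y (trig B (- A) y).
Proof. unfold trig; auto_derive; [trivial|ring]. Qed.

Lemma trig_bound (A B y : R) : Rabs (trig A B y) <= Rabs A + Rabs B.
Proof.
  unfold trig; eapply Rle_trans; [apply Rabs_triang|].
  rewrite !Rabs_mult.
  assert (Rabs (cos y) <= 1) by (apply Rabs_le, COS_bound).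
  assert (Rabs (sin y) <= 1) by (apply Rabs_le, SIN_bound).
  assert (h := Rabs_pos A); assert (h' := Rabs_pos B); nra.
Qed.

Lemma trig_taylor_S (N : nat) (A B y : R) :
  trig_taylor (S N) A B y =
  trig_taylor N A B y + trig_coef (S N) A B / INR (fact (S N)) * y ^ S N.
Proof. apply sum_n_Rsucc. Qed.

Lemma trig_taylor_O (A B y : R) : trig_taylor 0 A B y = A.
Proof. unfold trig_taylor; rewrite sum_O; simpl; field. Qed.

Lemma is_derive_pow_fact (k : R) (n : nat) (y : R) :
  is_derive (fun z => k / INR (fact (S n)) * z ^ S n) y (k / INR (fact n) * y ^ n).
Proof.
  evar_last.
  - apply (is_derive_scal (fun z => z ^ S n)), is_derive_pow, is_derive_id.
  - replace (pred (S n)) with n by reflexivity.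
    rewrite fact_simpl, mult_INR.
    change (@one R_AbsRing) with 1.
    assert (F1 := INR_fact_neq_0 n); assert (F2 := not_0_INR (S n)).
    real_eq; field; split; [exact F1|apply F2; lia].
Qed.

Lemma is_derive_trig_taylor_S (N : nat) (A B y : R) :
  is_derive (trig_taylor (S N) A B) y (trig_taylor N B (- A) y).
Proof.
  induction N as [|N IH].
  - apply is_derive_ext with (fun z => A + B * z).
    + intros z; rewrite trig_taylor_S, trig_taylor_O; simpl; real_eq; field.
    + rewrite trig_taylor_O; auto_derive; [trivial|ring].
  - apply is_derive_ext with (fun z => trig_taylor (S N) A B z
      + trig_coef (S (S N)) A B / INR (fact (S (S N))) * z ^ S (S N)).
    + intros z; symmetry; apply trig_taylor_S.
    + rewrite trig_taylor_S; apply (is_derive_plus (V := R_NormedModule)); [exact IH|].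
      apply is_derive_pow_fact.
Qed.

(** One integration of a remainder estimate, done by the mean value theorem: bound minus function,
    called [e], vanishes at 0 and has nonnegative derivative on the positive axis. Passing to -f
    gives the lower bound, and reflection the negative arguments. *)
Lemma derive_pow_fact_bound (f df : R -> R) (C : R) (N : nat) (y : R) :
  f 0 = 0 -> (forall z, is_derive f z (df z)) ->
  (forall z, Rabs (df z) <= C * (Rabs z ^ N / INR (fact N))) ->
  Rabs (f y) <= C * (Rabs y ^ S N / INR (fact (S N))).
Proof.
  intros H0 Hd Hb.
  assert (Pos : forall (h dh : R -> R) z, h 0 = 0 -> (forall z, is_derive h z (dh z)) ->
    (forall z, Rabs (dh z) <= C * (Rabs z ^ N / INR (fact N))) ->
    0 <= z -> h z <= C * (z ^ S N / INR (fact (S N)))).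
  { clear; intros h dh z H0 Hd Hb Hz.
    pose (e w := C * (w ^ S N / INR (fact (S N))) - h w).
    assert (De : forall w, is_derive e w (C * (w ^ N / INR (fact N)) - dh w)).
    { intros w; unfold e; apply (is_derive_minus (V := R_NormedModule)); [|apply Hd].
      apply is_derive_ext with (fun w => C / INR (fact (S N)) * w ^ S N);
        [intros v; real_eq; field; apply INR_fact_neq_0|].
      replace (C * (w ^ N / INR (fact N))) with (C / INR (fact N) * w ^ N)
        by (field; apply INR_fact_neq_0).
      apply is_derive_pow_fact. }
    destruct (MVT_gen e 0 z _ (fun w _ => De w)) as [w [Hw E]].
    { intros w _; apply continuity_pt_filterlim, continuous_of_ex_derive.
      eexists; apply De. }
    rewrite Rmin_left, Rmax_right in Hw by lra.
    assert (Hbw := Hb w); rewrite (Rabs_pos_eq w) in Hbw by lra.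
    assert (p := Rle_abs (dh w)).
    assert (e0 : e 0 = 0) by (unfold e; rewrite H0, pow_i by lia; unfold Rdiv; ring).
    assert (0 <= e z) by nra.
    unfold e in H; lra. }
  assert (Abs : forall (h dh : R -> R) z, h 0 = 0 -> (forall z, is_derive h z (dh z)) ->
    (forall z, Rabs (dh z) <= C * (Rabs z ^ N / INR (fact N))) ->
    0 <= z -> Rabs (h z) <= C * (z ^ S N / INR (fact (S N)))).
  { intros h dh z Hh Hdh Hbh Hz; apply Rabs_le; split; [|apply (Pos h dh); assumption].
    apply Ropp_le_cancel; rewrite Ropp_involutive.
    apply (Pos (fun w => - h w) (fun w => - dh w)); [lra| | |exact Hz].
    - intros w; apply (is_derive_opp (V := R_NormedModule)), Hdh.
    - intros w; rewrite Rabs_Ropp; apply Hbh. }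
  destruct (Rle_lt_dec 0 y) as [Hy|Hy].
  - rewrite (Rabs_pos_eq y) by exact Hy; apply (Abs f df); assumption.
  - rewrite (Rabs_left y) by exact Hy; rewrite <- (Ropp_involutive y) at 1.
    apply (Abs (fun w => f (- w)) (fun w => - df (- w))); [|intros w..|lra].
    + rewrite Ropp_0; exact H0.
    + evar_last; [apply (is_derive_comp f (fun w => - w)); [apply Hd|]|].
      * apply (is_derive_opp (V := R_NormedModule)), is_derive_id.
      * unfold scal, opp, one; simpl; unfold mult; simpl; ring.
    + rewrite Rabs_Ropp, <- (Rabs_Ropp w); apply Hb.
Qed.

Lemma trig_taylor_at_0 (N : nat) (A B : R) : trig_taylor N A B 0 = A.
Proof.
  induction N as [|N IH]; [apply trig_taylor_O|].
  rewrite trig_taylor_S, IH, pow_i by lia; ring.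
Qed.

(** The derivative of a remainder is the remainder of one degree less for (B, -A), and |A| + |B| is
    invariant under this exchange; the trivial bound is integrated N + 1 times. *)
Lemma trig_taylor_remainder (N : nat) (A B y : R) :
  Rabs (trig A B y - trig_taylor N A B y)
  <= (Rabs A + Rabs B) * (Rabs y ^ S N / INR (fact (S N))).
Proof.
  revert A B y; induction N as [|N IH]; intros A B y.
  - apply (derive_pow_fact_bound (fun z => trig A B z - trig_taylor 0 A B z)
      (fun z => trig B (- A) z)).
    + unfold trig; rewrite trig_taylor_O, cos_0, sin_0; ring.
    + intros z; apply is_derive_ext with (fun z => trig A B z - A).
      { intros w; rewrite trig_taylor_O; reflexivity. }
      evar_last; [apply (is_derive_minus (V := R_NormedModule));
        [apply is_derive_trig|apply is_derive_const]|].
      unfold minus, plus, opp, zero; simpl; ring.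
    + intros z; simpl; eapply Rle_trans; [apply trig_bound|].
      rewrite Rabs_Ropp; lra.
  - apply (derive_pow_fact_bound (fun z => trig A B z - trig_taylor (S N) A B z)
      (fun z => trig B (- A) z - trig_taylor N B (- A) z)).
    + unfold trig; rewrite trig_taylor_at_0, cos_0, sin_0; ring.
    + intros z; apply (is_derive_minus (V := R_NormedModule));
        [apply is_derive_trig|apply is_derive_trig_taylor_S].
    + intros z; eapply Rle_trans; [apply IH|].
      rewrite Rabs_Ropp, (Rplus_comm (Rabs B)); apply Rle_refl.
Qed.

(** By the mean value theorem, since the derivative of the remainder is again a remainder and so is
    factorially small. *)
Lemma trig_taylor_remainder_lipschitz (N : nat) (A B r y z : R) :
  Rabs y <= r -> Rabs z <= r ->
  Rabs ((trig A B y - trig_taylor (S N) A B y)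
        - (trig A B z - trig_taylor (S N) A B z))
  <= (Rabs A + Rabs B) * (r ^ S N / INR (fact (S N))) * Rabs (y - z).
Proof.
  intros Hy Hz.
  assert (De : forall w, is_derive (fun w => trig A B w - trig_taylor (S N) A B w) w
    (trig B (- A) w - trig_taylor N B (- A) w)).
  { intros w; apply (is_derive_minus (V := R_NormedModule));
        [apply is_derive_trig|apply is_derive_trig_taylor_S]. }
  destruct (MVT_gen _ z y _ (fun w _ => De w)) as [w [Hw E]].
  { intros w _; apply continuity_pt_filterlim.
    apply (continuous_of_ex_derive (fun w => trig A B w - trig_taylor (S N) A B w)).
    eexists; apply De. }
  cbv beta in E.
  rewrite E, Rabs_mult; apply Rmult_le_compat_r; [apply Rabs_pos|].
  eapply Rle_trans; [apply trig_taylor_remainder|].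
  rewrite Rabs_Ropp, (Rplus_comm (Rabs B)).
  assert (h := Rabs_pos A); assert (h' := Rabs_pos B).
  apply Rmult_le_compat_l; [lra|].
  apply Rmult_le_compat_r; [apply Rlt_le, Rinv_0_lt_compat, INR_fact_lt_0|].
  apply pow_incr; split; [apply Rabs_pos|].
  apply Rabs_le_between in Hy; apply Rabs_le_between in Hz.
  apply Rabs_le; revert Hw; unfold Rmin, Rmax; destruct Rle_dec; lra.
Qed.

Section Transform.
Variables (c A B : R) (psi : R -> R).
Hypothesis c_pos : 0 < c.
Hypothesis psi_int : ex_RInt psi (-1) 1.

Definition transform (x : R) : R := RInt (fun s => psi s * trig A B (c * x * s)) (-1) 1.

(** The Taylor coefficient of [transform] at 0, found by expanding the kernel under the integral. *)
Definition transform_coef (m : nat) : R :=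
  trig_coef m A B / INR (fact m) * c ^ m * RInt (fun s => psi s * s ^ m) (-1) 1.

Definition transform_const : R :=
  (Rabs A + Rabs B) * RInt (fun s => Rabs (psi s)) (-1) 1.

Lemma ex_derive_trig_taylor_scale (N : nat) (k s : R) :
  ex_derive (fun s => trig_taylor N A B (k * s)) s.
Proof.
  assert (H : forall y, ex_derive (trig_taylor N A B) y).
  { intros y; destruct N as [|N].
    - apply ex_derive_ext with (fun _ => A); [intros w; symmetry; apply trig_taylor_O|].
      apply ex_derive_const.
    - eexists; apply is_derive_trig_taylor_S. }
  apply (ex_derive_comp (trig_taylor N A B) (fun s => k * s)); [apply H|].
  auto_derive; trivial.
Qed.

Lemma ex_RInt_psi_monomial (m : nat) : ex_RInt (fun s => psi s * s ^ m) (-1) 1.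
Proof.
  apply ex_RInt_Rmult; [exact psi_int|].
  apply ex_RInt_of_ex_derive; intros x; auto_derive; trivial.
Qed.

Lemma ex_RInt_psi_taylor (N : nat) (x : R) :
  ex_RInt (fun s => psi s * trig_taylor N A B (c * x * s)) (-1) 1.
Proof.
  apply ex_RInt_Rmult; [exact psi_int|].
  apply ex_RInt_of_ex_derive; intros s; apply ex_derive_trig_taylor_scale.
Qed.

Lemma ex_RInt_psi_trig (x : R) :
  ex_RInt (fun s => psi s * trig A B (c * x * s)) (-1) 1.
Proof.
  apply ex_RInt_Rmult; [exact psi_int|].
  apply ex_RInt_of_ex_derive; intros s; unfold trig; auto_derive; trivial.
Qed.

Lemma RInt_psi_taylor (N : nat) (x : R) :
  RInt (fun s => psi s * trig_taylor N A B (c * x * s)) (-1) 1 =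
  sum_n (fun m => transform_coef m * x ^ m) N.
Proof.
  assert (S1 : forall m, RInt (fun s => (trig_coef m A B / INR (fact m) * c ^ m * x ^ m)
     * (psi s * s ^ m)) (-1) 1 = transform_coef m * x ^ m).
  { intros m; rewrite RInt_Rscal by apply ex_RInt_psi_monomial.
    unfold transform_coef; real_eq; ring. }
  induction N as [|N IH].
  - rewrite sum_O, <- S1; apply RInt_ext; intros s _.
    rewrite trig_taylor_O; simpl; real_eq; field.
  - rewrite sum_n_Rsucc, <- IH, <- S1, <- RInt_Rplus.
    + apply RInt_ext; intros s _; rewrite trig_taylor_S, !Rpow_mult_distr; real_eq; ring.
    + apply ex_RInt_psi_taylor.
    + apply ex_RInt_Rscal, ex_RInt_psi_monomial.
Qed.

(** The power of |x| is kept in the bound because comparing orders at x = 0 is what isolates single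
    moments when the transform vanishes. *)
Lemma transform_remainder (N : nat) (x : R) :
  -1 <= x <= 1 ->
  Rabs (transform x - sum_n (fun m => transform_coef m * x ^ m) N)
  <= transform_const * ((c * Rabs x) ^ S N / INR (fact (S N))).
Proof.
  intros Hx; rewrite <- RInt_psi_taylor; unfold transform.
  rewrite <- (RInt_Rminus _ _ _ _ (ex_RInt_psi_trig x) (ex_RInt_psi_taylor N x)).
  set (E := (c * Rabs x) ^ S N / INR (fact (S N))).
  replace (transform_const * E)
    with (RInt (fun s => ((Rabs A + Rabs B) * E) * Rabs (psi s)) (-1) 1).
  - apply RInt_Rabs_le; [lra| | |].
    + apply ex_RInt_Rminus; [apply ex_RInt_psi_trig|apply ex_RInt_psi_taylor].
    + apply ex_RInt_Rscal, ex_RInt_Rabs, psi_int.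
    + intros s Hs; rewrite <- Rmult_minus_distr_l, Rabs_mult, Rmult_comm.
      apply Rmult_le_compat_r; [apply Rabs_pos|].
      eapply Rle_trans; [apply trig_taylor_remainder|].
      assert (h := Rabs_pos A); assert (h' := Rabs_pos B).
      apply Rmult_le_compat_l; [lra|].
      apply Rmult_le_compat_r; [apply Rlt_le, Rinv_0_lt_compat, INR_fact_lt_0|].
      apply pow_incr; split; [apply Rabs_pos|].
      rewrite !Rabs_mult, (Rabs_pos_eq c) by lra.
      assert (Rabs s <= 1) by (apply Rabs_le; lra).
      assert (0 <= c * Rabs x) by (apply Rmult_le_pos; [lra|apply Rabs_pos]).
      nra.
  - rewrite RInt_Rscal by apply ex_RInt_Rabs, psi_int.
    unfold transform_const; real_eq; ring.
Qed.

(** The arguments c x s and c t s lie in [-c, c] and differ by at most c |x - t|, whence the extra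
    factor [c]. This form survives division by x - t. *)
Lemma transform_remainder_lipschitz (N : nat) (x t : R) :
  -1 <= x <= 1 -> -1 <= t <= 1 ->
  Rabs ((transform x - sum_n (fun m => transform_coef m * x ^ m) (S N))
        - (transform t - sum_n (fun m => transform_coef m * t ^ m) (S N)))
  <= transform_const * (c ^ S N / INR (fact (S N)) * c) * Rabs (x - t).
Proof.
  intros Hx Ht; rewrite <- !RInt_psi_taylor; unfold transform.
  assert (I1 := ex_RInt_psi_trig); assert (I2 := ex_RInt_psi_taylor (S N)).
  assert (I3 : forall x, ex_RInt (fun s => psi s * trig A B (c * x * s)
    - psi s * trig_taylor (S N) A B (c * x * s)) (-1) 1)
    by (intros; apply ex_RInt_Rminus; auto).
  rewrite <- (RInt_Rminus _ _ _ _ (I1 x) (I2 x)), <- (RInt_Rminus _ _ _ _ (I1 t) (I2 t)).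
  rewrite <- (RInt_Rminus _ _ _ _ (I3 x) (I3 t)).
  set (E := c ^ S N / INR (fact (S N))).
  replace (transform_const * (E * c) * Rabs (x - t))
    with (RInt (fun s => ((Rabs A + Rabs B) * E * (c * Rabs (x - t))) * Rabs (psi s)) (-1) 1).
  - apply RInt_Rabs_le; [lra| | |].
    + apply ex_RInt_Rminus; auto.
    + apply ex_RInt_Rscal, ex_RInt_Rabs, psi_int.
    + intros s Hs; rewrite <- !Rmult_minus_distr_l, Rabs_mult, Rmult_comm.
      apply Rmult_le_compat_r; [apply Rabs_pos|].
      assert (Hcs : forall y, -1 <= y <= 1 -> Rabs (c * y * s) <= c).
      { intros y Hy; rewrite !Rabs_mult, (Rabs_pos_eq c) by lra.
        assert (Rabs s <= 1) by (apply Rabs_le; lra).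
        assert (Rabs y <= 1) by (apply Rabs_le; lra).
        assert (p := Rabs_pos y); assert (p' := Rabs_pos s).
        rewrite Rmult_assoc; assert (Rabs y * Rabs s <= 1) by nra; nra. }
      eapply Rle_trans;
        [apply (trig_taylor_remainder_lipschitz N A B c); apply Hcs; assumption|].
      fold E; apply Rmult_le_compat_l.
      * assert (h := Rabs_pos A); assert (h' := Rabs_pos B).
        apply Rmult_le_pos; [lra|].
        apply Rlt_le, Rdiv_lt_0_compat; [apply pow_lt, c_pos|apply INR_fact_lt_0].
      * replace (c * x * s - c * t * s) with (c * (x - t) * s) by ring.
        rewrite !Rabs_mult, (Rabs_pos_eq c) by lra.
        assert (Rabs s <= 1) by (apply Rabs_le; lra).
        assert (0 <= c * Rabs (x - t)) by (apply Rmult_le_pos; [lra|apply Rabs_pos]).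
        nra.
  - rewrite RInt_Rscal by apply ex_RInt_Rabs, psi_int.
    unfold transform_const; real_eq; ring.
Qed.

End Transform.

(** * The kernel of the finite Fourier transform *)

(** For A = B = 1 no derivative at 0 vanishes, so every moment is visible; cosine or sine alone
    would only see the moments of one parity. *)
Lemma trig_coef_abs1 (m : nat) (A B : R) :
  Rabs A = 1 -> Rabs B = 1 -> Rabs (trig_coef m A B) = 1.
Proof.
  revert A B; induction m as [|m IH]; intros A B HA HB; [exact HA|].
  apply IH; [exact HB|rewrite Rabs_Ropp; exact HA].
Qed.

Lemma sum_n_zero_before (w : nat -> R) (n : nat) :
  (forall m, (m < n)%nat -> w m = 0) -> sum_n w n = w n.
Proof.
  induction n as [|n IH]; intros H; [apply sum_O|].
  rewrite sum_n_Rsucc, IH, (H n) by auto with arith; apply Rplus_0_l.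
Qed.

(** Once the lower moments vanish, the Taylor polynomial of the zero transform is its single term of
    degree [m], which is thus O(|x|^(m+1)); dividing by x^m and taking [x] small kills its
    coefficient. *)
Lemma moments_vanish (c : R) (psi : R -> R) :
  0 < c -> ex_RInt psi (-1) 1 ->
  (forall x, -1 <= x <= 1 -> transform c 1 1 psi x = 0) ->
  forall m, RInt (fun s => psi s * s ^ m) (-1) 1 = 0.
Proof.
  intros Hc Hpsi H0 m; induction m as [m IH] using (well_founded_induction lt_wf).
  set (w := transform_coef c 1 1 psi).
  assert (Hw : forall k, (k < m)%nat -> w k = 0).
  { intros k Hk; unfold w, transform_coef; rewrite (IH k Hk); apply Rmult_0_r. }
  assert (Wm : w m = 0).
  { set (E := transform_const 1 1 psi * (c ^ S m / INR (fact (S m)))).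
    assert (HE : forall x, 0 < x <= 1 -> Rabs (w m) <= E * x).
    { intros x Hx.
      assert (T := transform_remainder c 1 1 psi Hc Hpsi m x ltac:(lra)).
      rewrite (sum_n_zero_before (fun m => transform_coef c 1 1 psi m * x ^ m)) in T.
      2: { intros k Hk; fold (w k); rewrite (Hw k Hk); apply Rmult_0_l. }
      fold (w m) in T; rewrite H0, Rminus_0_l, Rabs_Ropp, Rabs_mult in T by lra.
      rewrite (Rabs_pos_eq x), (Rabs_pos_eq (x ^ m)) in T by (try apply pow_le; lra).
      apply Rmult_le_reg_r with (x ^ m); [apply pow_lt; lra|].
      eapply Rle_trans; [exact T|]; apply Req_le; unfold E.
      rewrite Rpow_mult_distr; simpl (x ^ S m); unfold Rdiv; ring. }
    destruct (Req_dec (w m) 0) as [|Hn]; [assumption|exfalso].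
    assert (p := Rabs_pos_lt _ Hn).
    assert (E1 := HE 1 ltac:(lra)).
    (* A concrete small [x], for which E x is half of |w m|. The case x = 1 gives |w m| <= E, so
       this [x] lies in (0, 1]. *)
    assert (E2 := HE (Rabs (w m) / (2 * E))).
    assert (0 < E) by lra.
    assert (q : E * (Rabs (w m) / (2 * E)) = Rabs (w m) / 2) by (field; lra).
    rewrite q in E2.
    assert (0 < Rabs (w m) / (2 * E) <= 1); [|lra].
    split; [apply Rdiv_lt_0_compat; lra|].
    apply Rmult_le_reg_l with E; [assumption|rewrite q; lra]. }
  unfold w, transform_coef in Wm.
  apply Rmult_integral in Wm; destruct Wm as [Wm|Wm]; [|exact Wm].
  exfalso; apply Rmult_integral in Wm; destruct Wm as [Wm|Wm];
    [apply Rmult_integral in Wm; destruct Wm as [Wm|Wm]|].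
  - assert (T := trig_coef_abs1 m 1 1 Rabs_R1 Rabs_R1).
    rewrite Wm, Rabs_R0 in T; lra.
  - assert (T := Rinv_0_lt_compat _ (INR_fact_lt_0 m)); lra.
  - assert (T := pow_lt c m Hc); lra.
Qed.

(** * Polynomial cutoffs and vanishing primitives *)

Lemma one_minus_pow_lower (z : R) (k : nat) :
  0 <= z <= 1 -> 1 - INR k * z <= (1 - z) ^ k.
Proof.
  intros Hz; induction k as [|k IH]; [simpl; lra|].
  rewrite S_INR; simpl; assert (p := pos_INR k).
  assert (0 <= INR k * z * z) by (repeat apply Rmult_le_pos; lra); nra.
Qed.

(** The upper counterpart of Bernoulli's inequality, (1 - z)^k <= 1/(1 + k z), from (1 - z)(1 +
    (k+1) z) <= 1 + k z. *)
Lemma one_minus_pow_upper (z : R) (k : nat) :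
  0 <= z <= 1 -> (1 - z) ^ k * (1 + INR k * z) <= 1.
Proof.
  intros Hz; induction k as [|k IH]; [simpl; lra|].
  rewrite S_INR; simpl; assert (p := pos_INR k).
  assert (q : 0 <= (1 - z) ^ k) by (apply pow_le; lra).
  assert (0 <= INR k * z * z) by (repeat apply Rmult_le_pos; lra).
  assert ((1 - z) * (1 + (INR k + 1) * z) <= 1 + INR k * z) by nra.
  replace ((1 - z) * (1 - z) ^ k * (1 + (INR k + 1) * z))
    with ((1 - z) ^ k * ((1 - z) * (1 + (INR k + 1) * z))) by ring.
  eapply Rle_trans; [apply Rmult_le_compat_l; eassumption|exact IH].
Qed.

(** The polynomials (1 - y^n)^(2^n) known from proofs of the Stone-Weierstrass theorem, with [y]
    affine in [x], in [0, 1], and equal to 1/2 at [u]. The deciding quantity 2^n y^n = (2y)^n tends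
    to 0 left of [u] and to infinity right of it. *)
Definition cutoff (u : R) (n : nat) (x : R) : R :=
  (1 - (/ 2 + (x - u) / 4) ^ n) ^ (2 ^ n).

Lemma cutoff_bounds (u x : R) (n : nat) :
  -1 <= u <= 1 -> -1 <= x <= 1 ->
  0 <= cutoff u n x <= 1 /\
  1 - (1 + (x - u) / 2) ^ n <= cutoff u n x /\
  cutoff u n x * (1 + (x - u) / 2) ^ n <= 1.
Proof.
  intros Hu Hx; unfold cutoff; set (y := / 2 + (x - u) / 4).
  assert (Hy : 0 <= y <= 1) by (unfold y; lra).
  assert (Hz : 0 <= y ^ n <= 1).
  { split; [apply pow_le; lra|].
    assert (h := pow_incr y 1 n Hy); rewrite pow1 in h; exact h. }
  assert (E : INR (2 ^ n) * y ^ n = (1 + (x - u) / 2) ^ n).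
  { rewrite pow_INR, <- Rpow_mult_distr; f_equal; unfold y; simpl; field. }
  rewrite <- E.
  assert (q : 0 <= (1 - y ^ n) ^ (2 ^ n) <= 1).
  { split; [apply pow_le; lra|].
    assert (h := pow_incr (1 - y ^ n) 1 (2 ^ n) ltac:(lra)).
    rewrite pow1 in h; exact h. }
  assert (L := one_minus_pow_lower _ (2 ^ n) Hz).
  assert (U := one_minus_pow_upper _ (2 ^ n) Hz).
  repeat split; lra.
Qed.

(** Testing against all monomial multiples of [f] makes the property stable under affine factors, so
    the cutoffs need never be expanded into powers of [x]. Differentiability secures integrability
    of the products. *)
Definition annihilated (psi f : R -> R) : Prop :=
  (forall x, ex_derive f x) /\
  forall j, RInt (fun s => psi s * (f s * s ^ j)) (-1) 1 = 0.

Lemma ex_RInt_psi_smooth (psi f : R -> R) (j : nat) :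
  ex_RInt psi (-1) 1 -> (forall x, ex_derive f x) ->
  ex_RInt (fun s => psi s * (f s * s ^ j)) (-1) 1.
Proof.
  intros Hpsi Hf; apply ex_RInt_Rmult; [exact Hpsi|].
  apply ex_RInt_of_ex_derive; intros x; auto_derive; auto.
Qed.

Lemma annihilated_affine (psi f : R -> R) (a b : R) :
  ex_RInt psi (-1) 1 -> annihilated psi f -> annihilated psi (fun x => (a + b * x) * f x).
Proof.
  intros Hpsi [Hf Hj]; split.
  - intros x; auto_derive; auto.
  - intros j.
    rewrite (RInt_ext _ (fun s => a * (psi s * (f s * s ^ j))
      + b * (psi s * (f s * s ^ S j)))) by (intros; simpl; real_eq; ring).
    assert (X := fun i => ex_RInt_psi_smooth psi f i Hpsi Hf).
    rewrite (RInt_Rplus _ _ _ _ (ex_RInt_Rscal _ _ _ a (X j))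
                                (ex_RInt_Rscal _ _ _ b (X (S j)))).
    rewrite (RInt_Rscal _ _ _ a (X j)), (RInt_Rscal _ _ _ b (X (S j))), !Hj.
    real_eq; ring.
Qed.

(** Induction on the outer exponent with [n] fixed: a further factor 1 - y^n subtracts the product
    with y^n, that is, with [n] affine factors. *)
Lemma annihilated_cutoff (psi : R -> R) (u : R) (n : nat) :
  ex_RInt psi (-1) 1 ->
  (forall m, RInt (fun s => psi s * s ^ m) (-1) 1 = 0) ->
  annihilated psi (cutoff u n).
Proof.
  intros Hpsi Hm; unfold cutoff; generalize (2 ^ n)%nat as k.
  assert (Ext : forall f g, (forall x, f x = g x) -> annihilated psi f -> annihilated psi g).
  { intros f g E [Hf Hj]; split.
    - intros x; apply ex_derive_ext with f; auto.
    - intros j; rewrite <- (Hj j); apply RInt_ext; intros; rewrite E; reflexivity. }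
  assert (Pow : forall i f, annihilated psi f ->
    annihilated psi (fun x => (/ 2 + (x - u) / 4) ^ i * f x)).
  { intros i f Hf; induction i as [|i IH].
    - apply (Ext f); [intros; simpl; ring|exact Hf].
    - apply (Ext (fun x => (/ 2 - u / 4 + / 4 * x) * ((/ 2 + (x - u) / 4) ^ i * f x)));
        [intros; simpl; field|].
      apply annihilated_affine; assumption. }
  induction k as [|k IH].
  - split; [intros x; simpl; apply ex_derive_const|].
    intros j; rewrite <- (Hm j); apply RInt_ext; intros; simpl; real_eq; ring.
  - destruct (Pow n _ IH) as [Hf Hj]; destruct IH as [Hf' Hj']; split.
    + intros x; auto_derive; trivial.
    + intros j.
      rewrite (RInt_ext _ (fun s => psi s * ((1 - (/ 2 + (s - u) / 4) ^ n) ^ k * s ^ j)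
        - psi s * ((/ 2 + (s - u) / 4) ^ n * (1 - (/ 2 + (s - u) / 4) ^ n) ^ k * s ^ j)))
        by (intros; simpl; real_eq; ring).
      rewrite RInt_Rminus, Hj', Hj; [apply Rminus_0_r|apply ex_RInt_psi_smooth; assumption..].
Qed.

Lemma RInt_left_power (u : R) (n : nat) :
  -1 <= u <= 1 ->
  ex_RInt (fun x => (1 + (x - u) / 2) ^ n) (-1) u /\
  RInt (fun x => (1 + (x - u) / 2) ^ n) (-1) u <= 2 / (INR n + 1).
Proof.
  intros Hu; assert (p := pos_INR n).
  assert (D : is_RInt (fun x => (1 + (x - u) / 2) ^ n) (-1) u
    (2 / (INR n + 1) - 2 / (INR n + 1) * (1 + (-1 - u) / 2) ^ S n)).
  { evar_last.
    - apply (is_RInt_derive (fun x => 2 / (INR n + 1) * (1 + (x - u) / 2) ^ S n)).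
      + intros x _; evar_last.
        * apply (is_derive_scal (fun x => (1 + (x - u) / 2) ^ S n)), is_derive_pow.
          instantiate (1 := / 2); auto_derive; [trivial|field].
        * replace (pred (S n)) with n by reflexivity; rewrite S_INR; real_eq; field; lra.
      + intros x _; apply continuous_of_ex_derive; auto_derive; trivial.
    - cbv beta; replace (1 + (u - u) / 2) with 1 by field; rewrite pow1.
      unfold minus, plus, opp; simpl; ring. }
  split; [eexists; exact D|].
  rewrite (is_RInt_unique _ _ _ _ D).
  assert (0 <= 2 / (INR n + 1) * (1 + (-1 - u) / 2) ^ S n); [|lra].
  apply Rmult_le_pos; [apply Rlt_le, Rdiv_lt_0_compat; lra|apply pow_le; lra].
Qed.

Lemma RInt_right_power (u : R) (m : nat) :
  -1 <= u <= 1 -> (0 < m)%nat ->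
  ex_RInt (fun x => (/ (1 + (x - u) / 2)) ^ S m) u 1 /\
  RInt (fun x => (/ (1 + (x - u) / 2)) ^ S m) u 1 <= 2 / INR m.
Proof.
  intros Hu Hm; assert (p := lt_0_INR m Hm).
  assert (D : is_RInt (fun x => (/ (1 + (x - u) / 2)) ^ S m) u 1
    (2 / INR m - 2 / INR m * (/ (1 + (1 - u) / 2)) ^ m)).
  { evar_last.
    - apply (is_RInt_derive (fun x => - (2 / INR m) * (/ (1 + (x - u) / 2)) ^ m)).
      + rewrite Rmin_left, Rmax_right by lra; intros x Hx; evar_last.
        * apply (is_derive_scal (fun x => (/ (1 + (x - u) / 2)) ^ m)), is_derive_pow.
          instantiate (1 := - / 2 * (/ (1 + (x - u) / 2) * / (1 + (x - u) / 2))).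
          auto_derive; [lra|field; lra].
        * destruct m as [|m]; [lia|]; replace (pred (S m)) with m by reflexivity.
          simpl (_ ^ S (S m)); simpl (_ ^ S m).
          generalize (/ (1 + (x - u) / 2)); intros v; real_eq; field; lra.
      + rewrite Rmin_left, Rmax_right by lra; intros x Hx.
        apply continuous_of_ex_derive; auto_derive; lra.
    - cbv beta; replace (1 + (u - u) / 2) with 1 by field; rewrite Rinv_1, pow1.
      unfold minus, plus, opp; simpl; ring. }
  split; [eexists; exact D|].
  rewrite (is_RInt_unique _ _ _ _ D).
  assert (0 <= 2 / INR m * (/ (1 + (1 - u) / 2)) ^ m); [|lra].
  apply Rmult_le_pos; [apply Rlt_le, Rdiv_lt_0_compat; lra|].
  apply pow_le, Rlt_le, Rinv_0_lt_compat; lra.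
Qed.

(* The polynomials [cutoff u n] converge boundedly to the indicator function of
   [[-1, u)], with an [L^1] error of order [1/n]. *)
Lemma primitive_vanishes (psi : R -> R) (u : R) :
  ex_RInt psi (-1) 1 ->
  (forall m, RInt (fun s => psi s * s ^ m) (-1) 1 = 0) ->
  -1 <= u <= 1 -> RInt psi (-1) u = 0.
Proof.
  intros Hpsi Hm Hu.
  destruct (ex_RInt_ub psi (-1) 1 Hpsi) as [M HM].
  change (norm (V := R_NormedModule)) with Rabs in HM.
  rewrite Rmin_left, Rmax_right in HM by lra.
  assert (Mpos : 0 <= M).
  { apply Rle_trans with (Rabs (psi 0)); [apply Rabs_pos|apply HM; lra]. }
  assert (Sub : forall f : R -> R, ex_RInt f (-1) 1 -> ex_RInt f (-1) u /\ ex_RInt f u 1).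
  { intros f Hf; split.
    - apply (ex_RInt_Chasles_1 (V := R_CompleteNormedModule)) with 1; [lra|exact Hf].
    - apply (ex_RInt_Chasles_2 (V := R_CompleteNormedModule)) with (-1); [lra|exact Hf]. }
  destruct (Sub psi Hpsi) as [Hl Hr].
  (* The integral of psi times the cutoff is 0; split at [u], its left part is close to the integral
     of [psi] and its right part is close to 0. Each error is at most 2M/m. *)
  assert (B : forall m, (0 < m)%nat -> Rabs (RInt psi (-1) u) <= 4 * M / INR m).
  { intros m Hm0.
    destruct (annihilated_cutoff psi u (S m) Hpsi Hm) as [Hd Hj].
    assert (Hq : ex_RInt (fun s => psi s * cutoff u (S m) s) (-1) 1)
      by (apply ex_RInt_Rmult; [exact Hpsi|apply ex_RInt_of_ex_derive, Hd]).
    destruct (Sub _ Hq) as [Hql Hqr].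
    assert (Z : RInt (fun s => psi s * cutoff u (S m) s) (-1) u
              + RInt (fun s => psi s * cutoff u (S m) s) u 1 = 0).
    { rewrite <- RInt_RChasles by assumption; rewrite <- (Hj 0%nat).
      apply RInt_ext; intros; simpl; rewrite Rmult_1_r; reflexivity. }
    destruct (RInt_left_power u (S m) Hu) as [L1 L2].
    destruct (RInt_right_power u m Hu Hm0) as [R1 R2].
    assert (p := lt_0_INR m Hm0).
    assert (EL : Rabs (RInt psi (-1) u - RInt (fun s => psi s * cutoff u (S m) s) (-1) u)
      <= M * (2 / (INR (S m) + 1))).
    { rewrite <- RInt_Rminus by assumption.
      apply Rle_trans with (RInt (fun x => M * (1 + (x - u) / 2) ^ S m) (-1) u).
      - apply RInt_Rabs_le; [lra|apply ex_RInt_Rminus; assumption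
          |apply ex_RInt_Rscal, L1|].
        intros x Hx; replace (psi x - psi x * cutoff u (S m) x)
          with (psi x * (1 - cutoff u (S m) x)) by ring.
        destruct (cutoff_bounds u x (S m) Hu ltac:(lra)) as (C1 & C2 & _).
        rewrite Rabs_mult, (Rabs_pos_eq (1 - _)) by lra.
        apply Rmult_le_compat; [apply Rabs_pos|lra|apply HM; lra|lra].
      - rewrite RInt_Rscal by exact L1; apply Rmult_le_compat_l; assumption. }
    assert (ER : Rabs (RInt (fun s => psi s * cutoff u (S m) s) u 1)
      <= M * (2 / INR m)).
    { apply Rle_trans with (RInt (fun x => M * (/ (1 + (x - u) / 2)) ^ S m) u 1).
      - apply RInt_Rabs_le; [lra|assumption|apply ex_RInt_Rscal, R1|].
        intros x Hx.
        destruct (cutoff_bounds u x (S m) Hu ltac:(lra)) as (C1 & _ & C2).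
        rewrite Rabs_mult, (Rabs_pos_eq (cutoff _ _ _)) by lra.
        apply Rmult_le_compat; [apply Rabs_pos|lra|apply HM; lra|].
        assert (V : 0 < (1 + (x - u) / 2) ^ S m) by (apply pow_lt; lra).
        rewrite pow_inv; apply Rmult_le_reg_r with ((1 + (x - u) / 2) ^ S m);
          [exact V|rewrite Rinv_l by lra; exact C2].
      - rewrite RInt_Rscal by exact R1; apply Rmult_le_compat_l; assumption. }
    assert (F : M * (2 / (INR (S m) + 1)) <= M * (2 / INR m)).
    { apply Rmult_le_compat_l; [assumption|].
      apply Rmult_le_compat_l; [lra|]; apply Rinv_le_contravar; [assumption|].
      rewrite S_INR; lra. }
    replace (4 * M / INR m) with (M * (2 / INR m) + M * (2 / INR m)) by (field; lra).
    replace (RInt psi (-1) u) with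
      ((RInt psi (-1) u - RInt (fun s => psi s * cutoff u (S m) s) (-1) u)
       - RInt (fun s => psi s * cutoff u (S m) s) u 1) by lra.
    eapply Rle_trans; [apply Rabs_triang|]; rewrite Rabs_Ropp; lra. }
  apply cond_eq; intros eps Heps; rewrite Rminus_0_r.
  destruct (INR_unbounded (4 * M / eps)) as [m Hm1].
  assert (q : 0 <= 4 * M / eps).
  { apply Rmult_le_pos; [lra|apply Rlt_le, Rinv_0_lt_compat, Heps]. }
  assert (Hm0 : (0 < m)%nat) by (apply INR_lt; simpl; lra).
  eapply Rle_lt_trans; [apply (B m Hm0)|].
  assert (p := lt_0_INR m Hm0).
  apply Rmult_lt_reg_r with (INR m); [assumption|].
  replace (4 * M / INR m * INR m) with (4 * M / eps * eps) by (field; lra).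
  nra.
Qed.

Lemma fc_kernel_trivial (c : R) (psi : R -> R) :
  0 < c -> fc_eigen c psi 0 0 -> RInt (fun t => psi t * psi t) (-1) 1 = 0.
Proof.
  intros Hc [Hpsi H].
  assert (Hm : forall m, RInt (fun s => psi s * s ^ m) (-1) 1 = 0).
  (* The sum of the cosine and sine equations is the transform with A = B = 1. *)
  { apply (moments_vanish c); [exact Hc|exact Hpsi|].
    intros x Hx; destruct (H x Hx) as [H1 H2]; unfold transform.
    rewrite (RInt_ext _ (fun s => psi s * cos (c * x * s) + psi s * sin (c * x * s)))
      by (intros; unfold trig; real_eq; ring).
    rewrite RInt_Rplus, H1, H2; [ring|..];
      (apply ex_RInt_Rmult; [exact Hpsi|apply ex_RInt_of_ex_derive]);
      intros y; auto_derive; trivial. }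
  assert (Hp := primitive_vanishes psi).
  apply RInt_square_zero; [lra|exact Hpsi|].
  intros u v Hu Huv Hv.
  assert (A1 : ex_RInt psi (-1) v)
    by (apply (ex_RInt_Chasles_1 (V := R_CompleteNormedModule)) with 1; [lra|exact Hpsi]).
  assert (E : RInt psi (-1) v = RInt psi (-1) u + RInt psi u v).
  { apply RInt_RChasles.
    - apply (ex_RInt_Chasles_1 (V := R_CompleteNormedModule)) with v; [lra|exact A1].
    - apply (ex_RInt_Chasles_2 (V := R_CompleteNormedModule)) with (-1); [lra|exact A1]. }
  rewrite !Hp in E by (assumption || lra); lra.
Qed.

(** * Convergence of the series *)

Lemma sum_n_Rscal (l : R) (u : nat -> R) (n : nat) :
  sum_n (fun k => l * u k) n = l * sum_n u n.
Proof. exact (sum_n_scal_l l u n). Qed.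

(** The polynomial (x^m - t^m)/(x - t), defined without division so that x = t is harmless. *)
Fixpoint pow_quotient (m : nat) (t x : R) : R :=
  match m with
  | O => 0
  | S m' => x ^ m' + t * pow_quotient m' t x
  end.

Lemma pow_quotientE (m : nat) (t x : R) :
  x ^ m - t ^ m = (x - t) * pow_quotient m t x.
Proof.
  induction m as [|m IH]; simpl; [ring|].
  replace ((x - t) * (x ^ m + t * pow_quotient m t x))
    with ((x - t) * x ^ m + t * ((x - t) * pow_quotient m t x)) by ring.
  rewrite <- IH; ring.
Qed.

Lemma ex_derive_pow_quotient (m : nat) (t x : R) : ex_derive (pow_quotient m t) x.
Proof.
  induction m as [|m IH]; [apply ex_derive_const|].
  simpl; auto_derive; auto.
Qed.

Lemma ex_RInt_legendreP_mult (k : nat) (f : R -> R) (a b : R) :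
  ex_RInt f a b -> ex_RInt (fun x => legendreP k x * f x) a b.
Proof.
  apply ex_RInt_Rmult, ex_RInt_of_ex_derive, ex_derive_legendreP.
Qed.

Lemma pow_quotient_orthogonal (m k : nat) (t : R) :
  (m <= k)%nat -> RInt (fun x => legendreP k x * pow_quotient m t x) (-1) 1 = 0.
Proof.
  induction m as [|m IH]; intros Hk.
  - rewrite (RInt_ext _ (fun _ => 0)) by (intros; simpl; apply Rmult_0_r).
    rewrite RInt_const; apply Rmult_0_r.
  - rewrite (RInt_ext _ (fun x => legendreP k x * x ^ m
      + t * (legendreP k x * pow_quotient m t x)))
      by (intros; simpl; real_eq; ring).
    assert (X : ex_RInt (fun x => legendreP k x * pow_quotient m t x) (-1) 1)
      by (apply ex_RInt_legendreP_mult, ex_RInt_of_ex_derive, ex_derive_pow_quotient).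
    assert (Y : ex_RInt (fun x => legendreP k x * x ^ m) (-1) 1)
      by (apply ex_RInt_legendreP_mult, ex_RInt_of_ex_derive;
          intros y; auto_derive; trivial).
    rewrite (RInt_Rplus _ _ _ _ Y (ex_RInt_Rscal _ _ _ t X)), (RInt_Rscal _ _ _ _ X).
    rewrite IH, legendreP_orthogonal by lia.
    real_eq; ring.
Qed.

Definition poly_quotient (w : nat -> R) (N : nat) (t x : R) : R :=
  sum_n (fun m => w m * pow_quotient m t x) N.

Lemma poly_quotientE (w : nat -> R) (N : nat) (t x : R) :
  sum_n (fun m => w m * x ^ m) N - sum_n (fun m => w m * t ^ m) N
  = (x - t) * poly_quotient w N t x.
Proof.
  unfold poly_quotient; rewrite <- sum_n_Rscal.
  induction N as [|N IH]; [rewrite !sum_O; simpl; ring|].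
  rewrite !sum_n_Rsucc, <- IH.
  assert (E := pow_quotientE (S N) t x).
  replace ((x - t) * (w (S N) * pow_quotient (S N) t x))
    with (w (S N) * ((x - t) * pow_quotient (S N) t x)) by ring.
  rewrite <- E; ring.
Qed.

Lemma ex_RInt_poly_quotient (w : nat -> R) (N : nat) (t a b : R) :
  ex_RInt (poly_quotient w N t) a b.
Proof.
  eexists; apply (is_RInt_sum_n (fun m x => w m * pow_quotient m t x)).
  intros k _; apply ex_RInt_Rscal, ex_RInt_of_ex_derive, ex_derive_pow_quotient.
Qed.

(** Division by x - t lowers the degree by one, so orthogonality already holds at k = N. *)
Lemma poly_quotient_orthogonal (w : nat -> R) (N k : nat) (t : R) :
  (N <= k)%nat -> RInt (fun x => legendreP k x * poly_quotient w N t x) (-1) 1 = 0.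
Proof.
  intros Hk.
  rewrite (RInt_ext _ (fun x => sum_n
    (fun m => w m * (legendreP k x * pow_quotient m t x)) N)).
  2: { intros x _; unfold poly_quotient; real_eq; rewrite <- sum_n_Rscal.
       apply sum_n_ext; intros m; real_eq; ring. }
  assert (X : forall m, ex_RInt (fun x => legendreP k x * pow_quotient m t x) (-1) 1)
    by (intros m; apply ex_RInt_legendreP_mult, ex_RInt_of_ex_derive,
          ex_derive_pow_quotient).
  rewrite (is_RInt_unique _ _ _ _ (is_RInt_sum_n
    (fun m x => w m * (legendreP k x * pow_quotient m t x)) _ _ _
    (fun m _ => ex_RInt_Rscal _ _ _ _ (X m)))).
  rewrite (sum_n_ext_loc _ (fun _ => 0)).
  - rewrite sum_n_const; apply Rmult_0_r.
  - intros m Hm; rewrite RInt_Rscal by apply X.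
    rewrite pow_quotient_orthogonal by lia; apply Rmult_0_r.
Qed.

(** Writing psi x as (t - x) times the quotient brings in exactly the factor with which
    Christoffel-Darboux collapses the sum under the integral. *)
Lemma legendre_partial_sum (psi : R -> R) (t : R) (N : nat) :
  ex_RInt psi (-1) 1 -> psi t = 0 ->
  ex_RInt (fun x => psi x / (t - x)) (-1) 1 ->
  sum_n (fun k => legendre_coef psi k * legendreQ k t) N =
  / 2 * RInt (fun x => psi x / (t - x)) (-1) 1
  + (INR N + 1) / 2 *
    (legendreQ (S N) t * RInt (fun x => legendreP N x * (psi x / (t - x))) (-1) 1
     - legendreQ N t * RInt (fun x => legendreP (S N) x * (psi x / (t - x))) (-1) 1).
Proof.
  intros Hpsi Ht Hg.
  assert (Xp : forall k, ex_RInt (fun x => psi x * legendreP k x) (-1) 1).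
  { intros k; apply ex_RInt_Rmult; [exact Hpsi|].
    apply ex_RInt_of_ex_derive, ex_derive_legendreP. }
  assert (Xg : forall k, ex_RInt (fun x => legendreP k x * (psi x / (t - x))) (-1) 1)
    by (intros k; apply ex_RInt_legendreP_mult, Hg).
  set (u := (INR N + 1) / 2).
  rewrite (sum_n_ext _ (fun k => RInt (fun x =>
    ((INR k + / 2) * legendreQ k t) * (psi x * legendreP k x)) (-1) 1)).
  2: { intros k; rewrite RInt_Rscal by apply Xp; unfold legendre_coef; real_eq; ring. }
  rewrite <- (is_RInt_unique _ _ _ _ (is_RInt_sum_n (fun k x =>
    ((INR k + / 2) * legendreQ k t) * (psi x * legendreP k x)) _ _ _
    (fun k _ => ex_RInt_Rscal _ _ _ _ (Xp k)))).
  rewrite (RInt_ext _ (fun x => / 2 * (psi x / (t - x))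
    + u * (legendreQ (S N) t * (legendreP N x * (psi x / (t - x)))
           - legendreQ N t * (legendreP (S N) x * (psi x / (t - x)))))).
  - assert (X1 := ex_RInt_Rscal _ _ _ (legendreQ (S N) t) (Xg N)).
    assert (X2 := ex_RInt_Rscal _ _ _ (legendreQ N t) (Xg (S N))).
    assert (X3 := ex_RInt_Rminus _ _ _ _ X1 X2).
    rewrite (RInt_Rplus _ _ _ _ (ex_RInt_Rscal _ _ _ _ Hg) (ex_RInt_Rscal _ _ _ u X3)).
    rewrite (RInt_Rscal _ _ _ _ Hg), (RInt_Rscal _ _ _ _ X3), (RInt_Rminus _ _ _ _ X1 X2).
    rewrite (RInt_Rscal _ _ _ _ (Xg N)), (RInt_Rscal _ _ _ _ (Xg (S N))).
    reflexivity.
  - intros x _.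
    rewrite (sum_n_ext _ (fun k => (psi x / 2) *
      ((2 * INR k + 1) * (legendreP k x * legendreQ k t)))) by (intros; real_eq; field).
    rewrite sum_n_Rscal.
    assert (CD := christoffel_darboux N x t).
    (* At x = t the quotient is [psi t] times the inverse of 0; both sides are 0 because [psi t]
       is. *)
    destruct (Req_dec x t) as [->|Hx].
    + rewrite Ht; unfold Rdiv; real_eq; ring.
    + replace (psi x / 2) with (/ 2 * (psi x / (t - x)) * (t - x)) by (field; lra).
      rewrite Rmult_assoc, CD; unfold u; real_eq; field; lra.
Qed.

Lemma INR_le_pow2 (n : nat) : INR n + 1 <= 2 ^ n.
Proof.
  induction n as [|n IH]; [simpl; lra|].
  rewrite S_INR; simpl; assert (p := pos_INR n); lra.
Qed.

Lemma legendre_series_of_transform (c A B : R) (psi : R -> R) (t : R) :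
  0 < c -> ex_RInt psi (-1) 1 ->
  (forall x, -1 <= x <= 1 -> transform c A B psi x = psi x) ->
  -1 < t < 1 -> psi t = 0 ->
  is_series (fun k => legendre_coef psi k * legendreQ k t)
    (/ 2 * RInt (fun x => psi x / (t - x)) (-1) 1).
Proof.
  intros Hc Hpsi Htr Ht Ht0.
  set (w := transform_coef c A B psi).
  set (K := transform_const A B psi).
  set (d N := K * (c ^ S N / INR (fact (S N)) * c)).
  (* The sign is due to [g] dividing by t - x and [poly_quotient] by x - t. *)
  set (q N x := (-1) * poly_quotient w (S N) t x).
  set (g x := psi x / (t - x)).
  (* As [psi t] is 0, (x - t)(g x - q N x) is, up to sign, the increment of the Taylor remainder
     between [t] and [x]. *)
  assert (Hd : forall N x, -1 <= x <= 1 -> x <> t -> Rabs (g x - q N x) <= d N).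
  { intros N x Hx Hxt.
    assert (L := transform_remainder_lipschitz c A B psi Hc Hpsi N x t Hx ltac:(lra)).
    rewrite !Htr, Ht0 in L by lra; fold w K in L.
    assert (E := poly_quotientE w (S N) t x).
    replace (psi x - sum_n (fun m => w m * x ^ m) (S N)
      - (0 - sum_n (fun m => w m * t ^ m) (S N)))
      with ((x - t) * - (g x - q N x)) in L.
    - rewrite Rabs_mult, Rabs_Ropp, Rmult_comm in L.
      apply Rmult_le_reg_r with (Rabs (x - t)); [apply Rabs_pos_lt; lra|exact L].
    - transitivity (psi x - (sum_n (fun m => w m * x ^ m) (S N)
        - sum_n (fun m => w m * t ^ m) (S N))); [|ring].
      rewrite E; unfold g, q; field; lra. }
  assert (Hdlim : is_lim_seq d 0).
  { unfold d; replace 0 with (K * (0 * c)) by ring.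
    apply (is_lim_seq_scal_l _ K (0 * c)), (is_lim_seq_scal_r _ c 0).
    apply (is_lim_seq_incr_1 (fun n => c ^ n / INR (fact n))).
    apply is_lim_seq_Reals, cv_speed_pow_fact. }
  assert (Hq : forall N a b, ex_RInt (q N) a b)
    by (intros; apply ex_RInt_Rscal, ex_RInt_poly_quotient).
  (* [Hd] says nothing at x = t, so integrals are treated separately on the two sides, where [t] is
     only an endpoint. *)
  assert (Hgl : ex_RInt g (-1) t).
  { apply (ex_RInt_uniform_limit q d); [lra|auto| |exact Hdlim].
    intros n x Hx; apply Hd; lra. }
  assert (Hgr : ex_RInt g t 1).
  { apply (ex_RInt_uniform_limit q d); [lra|auto| |exact Hdlim].
    intros n x Hx; apply Hd; lra. }
  assert (Hg : ex_RInt g (-1) 1)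
    by (apply (ex_RInt_Chasles (V := R_NormedModule)) with t; assumption).
  assert (Hdpos : forall N, 0 <= d N).
  { intros N; destruct (Req_dec 0 t) as [E|E].
    - eapply Rle_trans; [apply Rabs_pos|apply (Hd N (/ 2)); lra].
    - eapply Rle_trans; [apply Rabs_pos|apply (Hd N 0); lra]. }
  (* [q N] has degree at most [N], so subtracting it from [g] does not change the integral against
     P_k; the final 2 is the length of [-1, 1]. *)
  assert (HE : forall N k, (N < k)%nat ->
    Rabs (RInt (fun x => legendreP k x * g x) (-1) 1) <= 3 ^ k * d N * 2).
  { intros N k Hk.
    replace (RInt (fun x => legendreP k x * g x) (-1) 1)
      with (RInt (fun x => legendreP k x * (g x - q N x)) (-1) t
            + RInt (fun x => legendreP k x * (g x - q N x)) t 1).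
    - assert (Bd : forall x, -1 <= x <= 1 -> x <> t ->
        Rabs (legendreP k x * (g x - q N x)) <= 3 ^ k * d N).
      { intros x Hx Hxt; rewrite Rabs_mult.
        apply Rmult_le_compat; try apply Rabs_pos; auto.
        apply legendreP_bound, Hx. }
      assert (X : forall a b, ex_RInt g a b ->
        ex_RInt (fun x => legendreP k x * (g x - q N x)) a b)
        by (intros; apply ex_RInt_legendreP_mult, ex_RInt_Rminus; auto).
      eapply Rle_trans; [apply Rabs_triang|].
      replace (3 ^ k * d N * 2)
        with (3 ^ k * d N * (t - -1) + 3 ^ k * d N * (1 - t)) by ring.
      apply Rplus_le_compat; apply RInt_Rabs_le_const; auto; try lra;
        intros x Hx; apply Bd; lra.
    - rewrite <- RInt_RChasles by
        (apply ex_RInt_legendreP_mult, ex_RInt_Rminus; auto).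
      rewrite (RInt_ext _ (fun x => legendreP k x * g x
        - (-1) * (legendreP k x * poly_quotient w (S N) t x)))
        by (intros; unfold q; real_eq; ring).
      assert (X := ex_RInt_legendreP_mult k _ _ _ (ex_RInt_poly_quotient w (S N) t (-1) 1)).
      rewrite (RInt_Rminus _ _ _ _ (ex_RInt_legendreP_mult k _ _ _ Hg)
        (ex_RInt_Rscal _ _ _ (-1) X)), (RInt_Rscal _ _ _ _ X).
      rewrite poly_quotient_orthogonal by lia.
      real_eq; ring. }
  destruct (legendreQ_bound t Ht) as [C [HC HQ]].
  (* With N = j + 1, the base 18 = 2*3*3 collects N + 1 <= 2^N and the growth of both Legendre
     kinds. The two boundary products contribute 54 each; of 108/2 = 54, a factor 9 goes into the
     power of 18 c, leaving 6. *)
  set (D := 6 * C * Rabs K * c).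
  set (b j := D * ((18 * c) ^ S j / INR (fact (S j)))).
  assert (Hb : forall j, Rabs (sum_n (fun k => legendre_coef psi k * legendreQ k t) (S j)
    - / 2 * RInt g (-1) 1) <= b j).
  { intros j; rewrite (legendre_partial_sum psi t (S j) Hpsi Ht0 Hg).
    fold g.
    assert (E1 := HE j (S j) ltac:(lia)); assert (E2 := HE j (S (S j)) ltac:(lia)).
    assert (Q1 := HQ (S j)); assert (Q2 := HQ (S (S j))).
    unfold g in E1, E2 |- *.
    set (e1 := RInt (fun x => legendreP (S j) x * (psi x / (t - x))) (-1) 1) in *.
    set (e2 := RInt (fun x => legendreP (S (S j)) x * (psi x / (t - x))) (-1) 1) in *.
    set (q1 := legendreQ (S j) t) in *; set (q2 := legendreQ (S (S j)) t) in *.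
    match goal with |- Rabs (?a + ?z - ?a) <= _ => replace (a + z - a) with z by ring end.
    assert (T3 : 0 < 3 ^ j) by (apply pow_lt; lra).
    assert (Dj := Hdpos j).
    assert (M1 : Rabs (q2 * e1) <= (C * 3 ^ S (S j)) * (3 ^ S j * d j * 2))
      by (rewrite Rabs_mult; apply Rmult_le_compat; auto using Rabs_pos).
    assert (M2 : Rabs (q1 * e2) <= (C * 3 ^ S j) * (3 ^ S (S j) * d j * 2))
      by (rewrite Rabs_mult; apply Rmult_le_compat; auto using Rabs_pos).
    assert (M : Rabs (q2 * e1 - q1 * e2) <= 108 * C * (3 ^ j * 3 ^ j * d j)).
    { eapply Rle_trans; [apply Rabs_triang|]; rewrite Rabs_Ropp.
      simpl in M1, M2; lra. }
    rewrite Rabs_mult.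
    assert (p := pos_INR (S j)); rewrite (Rabs_pos_eq ((INR (S j) + 1) / 2)) by lra.
    assert (P2 := INR_le_pow2 (S j)).
    apply Rle_trans with (2 ^ S j / 2 * (108 * C * (3 ^ j * 3 ^ j * d j))).
    { apply Rmult_le_compat; [lra|apply Rabs_pos|lra|exact M]. }
    apply Rle_trans with (2 ^ S j / 2 * (108 * C * (3 ^ j * 3 ^ j *
      (Rabs K * (c ^ S j / INR (fact (S j)) * c))))).
    { repeat apply Rmult_le_compat_l; try lra.
      - apply Rmult_le_pos; lra.
      - apply Rmult_le_compat_r; [|apply Rle_abs].
        apply Rmult_le_pos; [|lra].
        apply Rlt_le, Rdiv_lt_0_compat; [apply pow_lt, Hc|apply INR_fact_lt_0]. }
    apply Req_le; unfold b, D.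
    replace (18 * c) with (2 * (3 * (3 * c))) by ring.
    rewrite !Rpow_mult_distr; simpl (3 ^ S j); field; apply INR_fact_neq_0. }
  assert (Hblim : is_lim_seq b 0).
  { unfold b; replace 0 with (D * 0) by ring.
    apply (is_lim_seq_scal_l _ D 0).
    apply (is_lim_seq_incr_1 (fun n => (18 * c) ^ n / INR (fact n))).
    apply is_lim_seq_Reals, cv_speed_pow_fact. }
  change (is_lim_seq (sum_n (fun k => legendre_coef psi k * legendreQ k t))
    (/ 2 * RInt g (-1) 1)).
  apply is_lim_seq_incr_1; apply is_lim_seq_spec; intros eps.
  apply is_lim_seq_spec in Hblim; destruct (Hblim eps) as [N HN].
  exists N; intros n Hn; specialize (HN n Hn); rewrite Rminus_0_r in HN.
  eapply Rle_lt_trans; [apply Hb|].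
  eapply Rle_lt_trans; [apply Rle_abs|exact HN].
Qed.

Theorem theorem67 (c : R) (n : nat) (psi : R -> R) :
  0 < c -> is_pswf c n psi ->
  forall tj : R, -1 < tj < 1 -> psi tj = 0 ->
    is_series (fun k => legendre_coef psi k * legendreQ k tj)
      (/ 2 * RInt (fun t => psi t / (tj - t)) (-1) 1).
Proof.
  intros Hc (a & b & Heig & Hnorm & _) tj Htj Hz.
  destruct (Req_dec (a ^ 2 + b ^ 2) 0) as [H0|H0].
  - exfalso.
    assert (a = 0) by nra; assert (b = 0) by nra; subst a b.
    assert (E := fc_kernel_trivial c psi Hc Heig).
    rewrite (RInt_ext _ (fun x => psi x * psi x)) in Hnorm
      by (intros; simpl; real_eq; ring).
    assert (h := eq_trans (eq_sym Hnorm) E); lra.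
  - destruct Heig as [Hpsi Heig].
    (* For lambda = a + ib these are the real part and minus the imaginary part of 1/lambda; the
       real part of F_c[psi]/lambda is [psi]. *)
    apply (legendre_series_of_transform c (a / (a ^ 2 + b ^ 2)) (b / (a ^ 2 + b ^ 2)));
      try assumption.
    intros x Hx; destruct (Heig x Hx) as [H1 H2]; unfold transform.
    assert (X1 : ex_RInt (fun s => psi s * cos (c * x * s)) (-1) 1)
      by (apply ex_RInt_Rmult; [exact Hpsi|apply ex_RInt_of_ex_derive];
          intros y; auto_derive; trivial).
    assert (X2 : ex_RInt (fun s => psi s * sin (c * x * s)) (-1) 1)
      by (apply ex_RInt_Rmult; [exact Hpsi|apply ex_RInt_of_ex_derive];
          intros y; auto_derive; trivial).
    rewrite (RInt_ext _ (fun s => a / (a ^ 2 + b ^ 2) * (psi s * cos (c * x * s))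
      + b / (a ^ 2 + b ^ 2) * (psi s * sin (c * x * s))))
      by (intros; unfold trig; real_eq; field; exact H0).
    rewrite RInt_Rplus by (apply ex_RInt_Rscal; assumption).
    rewrite (RInt_Rscal _ _ _ _ X1), (RInt_Rscal _ _ _ _ X2), H1, H2; field; exact H0.
Qed.
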